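(* Every integer $b\ge 1$ satisfies $$\frac{2\,(N(3,b)+1)}{3b}<\frac{7}{6}.$$
   Context: A nonzero polynomial $F\in\mathbb{C}[x,y]$ (or the curve $F=0$ in $\mathbb{A}^2(\mathbb{C})$, not necessarily reduced) has bidegree $(a,b)$ if every monomial $x^iy^j$ occurring in $F$ has $(i,j)$ in the triangle with vertices $(a,0)$, $(0,0)$, $(0,b)$. A point $s$ of a curve $C$ on a smooth surface is a singularity of type $A_k$ ($k\ge 1$) if there are local analytic coordinates around $s$ in which $C$ is given by $y^2-x^{k+1}=0$; by convention a smooth point is of type $A_0$. $N(a,b)$ denotes the maximal integer $k\ge 0$ such that there exists a curve in $\mathbb{A}^2(\mathbb{C})$ of bidegree $(a,b)$ with a singularity of type $A_k$. *)

(* Defs.v *)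
From HB Require Import structures.
From mathcomp Require Import all_boot all_order all_algebra.
From mathcomp Require Import complex.
From mathcomp Require Import all_classical all_reals all_analysis.

Set Implicit Arguments.
Unset Strict Implicit.
Unset Printing Implicit Defensive.

Import Order.TTheory GRing.Theory Num.Theory.
Import numFieldNormedType.Exports.

Local Open Scope classical_set_scope.
Local Open Scope ring_scope.

(* Going through [numClosedFieldType] (rather than using [R[i]] directly) makes
   the topology of numeric fields available by unification. *)
Definition Cplx (R : realType) : numClosedFieldType := R[i]%C.

(* A polynomial in C[x,y] is an [F : {poly {poly Cplx R}}] whose outer variable
   is x and whose inner variable is y: the coefficient of x^i y^j is
   [F`_i`_j]. *)
Definition eval2 (R : realType) (F : {poly {poly Cplx R}})
    (p : Cplx R * Cplx R) : Cplx R :=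
  F.[p.1%:P].[p.2].

Definition dx (R : realType) (F : {poly {poly Cplx R}}) : {poly {poly Cplx R}} :=
  F^`().

Definition dy (R : realType) (F : {poly {poly Cplx R}}) : {poly {poly Cplx R}} :=
  map_poly (@deriv (Cplx R)) F.

(* The point (i, j) is written as the barycentric combination
   (1 - u - v) (0, 0) + u (a, 0) + v (0, b). *)
Definition in_triangle (a b i j : nat) : Prop :=
  exists u v : rat,
    [/\ 0 <= u, 0 <= v, u + v <= 1, i%:R = u * a%:R & j%:R = v * b%:R].

Definition has_bidegree (R : realType) (a b : nat)
    (F : {poly {poly Cplx R}}) : Prop :=
  F != 0 /\ (forall i j : nat, F`_i`_j != 0 -> in_triangle a b i j).

(* [r] and [M] have type [Cplx R], but [0 < r] and [_ <= M] force them to be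
   real.  The bound [M] says that the double series converges absolutely on the
   closed polydisc of radius [r], so that the choice of square partial sums is
   immaterial. *)
Definition analytic_at (R : realType) (f : Cplx R * Cplx R -> Cplx R)
    (p : Cplx R * Cplx R) : Prop :=
  exists (c : nat -> nat -> Cplx R) (r M : Cplx R),
    [/\ 0 < r,
        forall n : nat,
          \sum_(i < n) \sum_(j < n) `|c i j| * r ^+ (i + j) <= M
      & forall u v : Cplx R, `|u| < r -> `|v| < r ->
          (fun n : nat => \sum_(i < n) \sum_(j < n) c i j * u ^+ i * v ^+ j)
            @ \oo --> f (p.1 + u, p.2 + v)].

Definition analytic_on (R : realType) (U : set (Cplx R * Cplx R))
    (f : Cplx R * Cplx R -> Cplx R) : Prop :=
  forall p, U p -> analytic_at f p.

Definition analytic_map_on (R : realType) (U : set (Cplx R * Cplx R))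
    (phi : Cplx R * Cplx R -> Cplx R * Cplx R) : Prop :=
  analytic_on U (fun p => (phi p).1) /\ analytic_on U (fun p => (phi p).2).

(* Local analytic coordinates around s: a bianalytic map from an open
   neighbourhood U of s onto an open neighbourhood of (0, 0), sending s to
   (0, 0); the coordinates of p in U are (phi p).1 and (phi p).2. *)
Definition local_coordinates (R : realType) (s : Cplx R * Cplx R)
    (U : set (Cplx R * Cplx R))
    (phi : Cplx R * Cplx R -> Cplx R * Cplx R) : Prop :=
  [/\ open U, U s, phi s = (0, 0)
    & exists (V : set (Cplx R * Cplx R))
             (psi : Cplx R * Cplx R -> Cplx R * Cplx R),
      [/\ open V,
          forall p, U p -> V (phi p) /\ psi (phi p) = p,
          forall q, V q -> U (psi q) /\ phi (psi q) = q,
          analytic_map_on U phi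
        & analytic_map_on V psi]].

Definition smooth_point (R : realType) (F : {poly {poly Cplx R}})
    (s : Cplx R * Cplx R) : Prop :=
  eval2 F s = 0 /\ (eval2 (dx F) s != 0 \/ eval2 (dy F) s != 0).

(* Curves are not necessarily reduced, so "given by y^2 - x^(k+1) = 0" is an
   equality of ideals of analytic functions near s: F is a nowhere vanishing
   analytic function times the model equation in the coordinates phi. *)
Definition given_by_Ak_equation (R : realType) (F : {poly {poly Cplx R}})
    (s : Cplx R * Cplx R) (k : nat) : Prop :=
  exists (U : set (Cplx R * Cplx R))
         (phi : Cplx R * Cplx R -> Cplx R * Cplx R)
         (e : Cplx R * Cplx R -> Cplx R),
    [/\ local_coordinates s U phi,
        analytic_on U e
      & forall p, U p -> e p != 0 /\
          eval2 F p = e p * ((phi p).2 ^+ 2 - (phi p).1 ^+ k.+1)].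

Definition has_type_A (R : realType) (F : {poly {poly Cplx R}})
    (s : Cplx R * Cplx R) (k : nat) : Prop :=
  if k is 0 then smooth_point F s else given_by_Ak_equation F s k.

Definition bidegree_curve_with_A (R : realType) (a b k : nat) : Prop :=
  exists (F : {poly {poly Cplx R}}) (s : Cplx R * Cplx R),
    has_bidegree a b F /\ has_type_A F s k.

(* [is_N R a b n] : the maximum N(a, b) exists and equals n. *)
Definition is_N (R : realType) (a b n : nat) : Prop :=
  bidegree_curve_with_A R a b n /\
  (forall k : nat, bidegree_curve_with_A R a b k -> (k <= n)%N).

(* Main.v *)
(* Write the curve, translated to its singular point, as the cubic
   [G = a u^3 + p(v) u^2 + q(v) u + r(v)], with [deg p <= b/3], [deg q <= 2b/3]
   and [deg r <= b].  Let [k >= 1] and let [(u, v) = (xi(t), eta(t))] be the arc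
   [t |-> (t^2, 0)] in the coordinates in which [G] is [y^2 - x^(k+1)] up to a
   unit.  Moving this arc by at most [t^(k+1)] keeps [G] of order [2(k+1)], so
   that both partial derivatives of [G] have order at least [k+1] along it.

   If [p(0) <> 0], the discriminant [D] of the cubic is [A G + B G_u^2], so [D]
   has order [2(k+1)] along the arc.  When [k >= 2] the arc is transverse to the
   fibre [v = 0], hence [v^(k+1)] divides [D].  Moreover [D <> 0], because
   otherwise every point of the curve near the origin would be singular.  For
   [a <> 0] one has [4 Q^3 + R^2 = - 27 a^2 D] with [deg Q <= 2b/3] and
   [deg R <= b], and the Wronskian [3 Q' R - 2 Q R'] is divisible by [v^k] (this
   is the argument of Mason, Stothers and Davenport); for [a = 0] one has
   [D = p^2 (q^2 - 4 p r)].  In both cases [3 (k+1) <= 5 b].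

   If [p(0) = 0], comparing orders along the arc shows that [k] is so small that
   the bound [4 (k+1) < 7 b] holds trivially. *)
Require Import Defs.
From mathcomp Require Import all_boot all_order all_algebra.
From mathcomp Require Import ring lra zify.
From mathcomp Require Import complex.
From mathcomp Require Import all_classical all_reals all_analysis.

Set Implicit Arguments.
Unset Strict Implicit.
Unset Printing Implicit Defensive.

Import Order.TTheory GRing.Theory Num.Theory.
Import numFieldNormedType.Exports.

Local Open Scope classical_set_scope.
Local Open Scope ring_scope.

(** * Zeros of cubic discriminants *)

Section Discriminant.
Variable K : numFieldType.
Implicit Types (a : K) (p q r : {poly K}).

Lemma Xn_dvdp_size p m : 'X^m %| p -> p != 0 -> (m < size p)%N.
Proof. by move=> dv p0; have := dvdp_leq p0 dv; rewrite size_polyXn. Qed.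

Lemma Xn_dvdp_mull p q m : p.[0] != 0 -> ('X^m %| p * q) = ('X^m %| q).
Proof.
move=> p0; apply: Gauss_dvdpr; apply: coprimep_expl.
by rewrite coprimep_sym coprimepX.
Qed.

(* With [Delta = 4 Q^3 + R^2] and [W = 3 Q' R - 2 Q R'] one has
   [Q Delta' - 3 Delta Q' = - R W]: a zero of [Delta] of order [m], at a point
   where [Q] does not vanish, is a zero of [W] of order exactly [m - 1]. *)
Lemma order_cube_square_le (Q R E : {poly K}) m n1 n2 :
  (size Q <= n1.+1)%N -> (size R <= n2.+1)%N -> Q.[0] != 0 -> (0 < m)%N ->
  E.[0] != 0 -> 4%:R * Q ^+ 3 + R ^+ 2 = 'X^m * E -> (m <= n1 + n2)%N.
Proof.
case: m => // m sQ sR Q0 _ E0 eD.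
(* If [R] vanished at [0], so would [4 Q^3], because the right-hand side does. *)
have R0 : R.[0] != 0.
  apply/eqP => R0; have /(congr1 (fun p => p.[0])) := eD.
  rewrite (exprS 'X m) -polyC_natr hornerD !hornerM !horner_exp hornerX hornerC R0.
  move=> e; have : 4%:R * Q.[0] ^+ 3 == 0 by apply/eqP; ring: e.
  by rewrite mulf_eq0 expf_eq0 (negPf Q0) pnatr_eq0.
set W := Q^`() * R *+ 3 - Q * R^`() *+ 2.
(* [T] is [Q Delta' - 3 Delta Q'] divided by [X^m]. The order is [m.+1] after the case split, whence
   the value [(m.+1) E(0) Q(0)] of [T] at [0]. *)
pose T := (m.+1%:R)%:P * (E * Q) + 'X * (E^`() * Q - 3%:R * E * Q^`()).
have eRW : - R * W = 'X^m * T.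
  have dXE : ('X^(m.+1) * E)^`() = 'X^m * ((m.+1%:R)%:P * E + 'X * E^`()).
    rewrite derivM derivXn /= polyC_natr mulr_natl mulrDr mulrnAl mulrnAr.
    by rewrite mulrA -exprSr.
  have eD' := congr1 (@deriv K) eD; rewrite dXE in eD'.
  have dQR : (4%:R * Q ^+ 3 + R ^+ 2)^`() =
      12%:R * Q ^+ 2 * Q^`() + 2%:R * R * R^`().
    by rewrite !poly.derivE /=; ring.
  rewrite dQR in eD'; move: eD eD'; rewrite /T /W (exprS 'X m).
  move: ((m.+1%:R)%:P : {poly K}) ('X^m : {poly K}) => c Xm e1 e2.
  transitivity (Q * (12%:R * Q ^+ 2 * Q^`() + 2%:R * R * R^`())
    - 3%:R * Q^`() * (4%:R * Q ^+ 3 + R ^+ 2)); first by ring.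
  by rewrite e1 e2; ring.
have T0 : T.[0] != 0.
  rewrite /T hornerD !hornerM hornerC hornerX mul0r addr0.
  by rewrite mulf_neq0 ?mulf_neq0 // pnatr_eq0.
have Tn0 : T != 0 by apply: contraNneq T0 => ->; rewrite horner0.
have Wn0 : W != 0.
  apply: contraNneq Tn0 => W0; move/eqP: eRW; rewrite W0 mulr0 eq_sym mulf_eq0.
  by rewrite expf_eq0 polyX_eq0 andbF.
have dvW : 'X^m %| W.
  rewrite -(@Xn_dvdp_mull (- R)); last by rewrite hornerN oppr_eq0.
  by rewrite eRW dvdp_mulr.
(* Differentiation lowers degrees, so [W] has size at most [n1 + n2]; then [m < size W] is exactly
   the bound for the original order [m.+1]. *)
have /leq_trans := Xn_dvdp_size dvW Wn0; apply.
have sd (P : {poly K}) : (size P^`() <= (size P).-1)%N by rewrite size_poly.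
have sm (P P' : {poly K}) : (size P <= n1)%N -> (size P' <= n2.+1)%N ->
    (size (P * P')%R <= n1 + n2)%N.
  by move=> h1 h2; apply: leq_trans (size_polyMleq _ _) _; lia.
have sm' (P P' : {poly K}) : (size P <= n1.+1)%N -> (size P' <= n2)%N ->
    (size (P * P')%R <= n1 + n2)%N.
  by move=> h1 h2; apply: leq_trans (size_polyMleq _ _) _; lia.
have szn (P : {poly K}) k : (size (P *+ k)%R <= size P)%N.
  by rewrite -scaler_nat size_scale_leq.
apply: leq_trans (size_polyD _ _) _; rewrite geq_max size_polyN.
apply/andP; split; apply: leq_trans (szn _ _) _.
  by apply: sm => //; have := sd Q; lia.
by apply: sm' => //; have := sd R; lia.
Qed.

(** The discriminant of [a u^3 + p u^2 + q u + r] with respect to [u]. *)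
Definition cubic_disc a p q r : {poly K} :=
  p ^+ 2 * q ^+ 2 - 4%:R * a%:P * q ^+ 3 - 4%:R * p ^+ 3 * r
  - 27%:R * a%:P ^+ 2 * r ^+ 2 + 18%:R * a%:P * p * q * r.

Lemma size_mul_le n1 n2 n p q : (size p <= n1.+1)%N -> (size q <= n2.+1)%N ->
  (n1 + n2 <= n)%N -> (size (p * q)%R <= n.+1)%N.
Proof. by move=> h1 h2 h; apply: leq_trans (size_polyMleq _ _) _; lia. Qed.

Lemma size_add_le p q n : (size p <= n)%N -> (size q <= n)%N ->
  (size (p + q)%R <= n)%N.
Proof.
by move=> h1 h2; apply: leq_trans (size_polyD _ _) _; rewrite geq_max h1.
Qed.

Lemma size_natpoly_le k n : (size (k%:R : {poly K}) <= n.+1)%N.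
Proof. by rewrite -polyC_natr; apply: leq_trans (size_polyC_leq1 _) _. Qed.

Lemma size_const_le a n : (size a%:P <= n.+1)%N.
Proof. by apply: leq_trans (size_polyC_leq1 _) _. Qed.

(** For [a = 0] the discriminant is [p^2 (q^2 - 4 p r)], and the second factor has degree at most
    [max (2 n2) (n1 + b)]. For [a <> 0] the preceding bound gives [m <= n2 + b]. *)
Lemma order_cubic_disc_le a p q r E m n1 n2 b :
  (size p <= n1.+1)%N -> (size q <= n2.+1)%N -> (size r <= b.+1)%N ->
  (2 * n1 <= n2)%N -> (n1 + n2 <= b)%N -> (3 * n2 <= 2 * b)%N ->
  p.[0] != 0 -> q.[0] = 0 -> E.[0] != 0 -> (0 < m)%N ->
  cubic_disc a p q r = 'X^m * E -> (3 * m <= 5 * b)%N.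
Proof.
move=> sp sq sr h1 h2 h3 p0 q0 E0 m0; case: (eqVneq a 0) => [-> eD|a0 eD].
  pose Z := q ^+ 2 - 4%:R * p * r.
  have eZ : 'X^m * E = p ^+ 2 * Z.
    by rewrite -eD /cubic_disc /Z polyC0; ring.
  have dvZ : 'X^m %| Z.
    rewrite -(@Xn_dvdp_mull (p ^+ 2)) -?eZ ?dvdp_mulr //.
    by rewrite horner_exp expf_neq0.
  have Z0 : Z != 0.
    apply: contraNneq E0 => Z0; move/eqP: eZ; rewrite Z0 mulr0 mulf_eq0.
    by rewrite expf_eq0 polyX_eq0 andbF /= => /eqP ->; rewrite horner0.
  have := Xn_dvdp_size dvZ Z0.
  suff : (size Z <= (maxn (n2 + n2) (n1 + b)).+1)%N by lia.
  apply: size_add_le.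
    by rewrite expr2; apply: (size_mul_le sq sq); rewrite leq_maxl.
  rewrite size_polyN; apply: (@size_mul_le n1 b) => //.
    by apply: (@size_mul_le 0 n1) => //; apply: size_natpoly_le.
  by rewrite leq_maxr.
(* Completing the cube: with [U = 3 a u + p], the cubic times [27 a^2] is [U^3 + 3 Q U + R]. *)
pose Q := 3%:R * a%:P * q - p ^+ 2.
pose R := 2%:R * p ^+ 3 - 9%:R * a%:P * p * q + 27%:R * a%:P ^+ 2 * r.
have eD' : 4%:R * Q ^+ 3 + R ^+ 2 = 'X^m * ((- 27%:R * a ^+ 2)%:P * E).
  rewrite [RHS]mulrCA -eD /Q /R /cubic_disc polyCM polyCN polyC_natr polyC_exp.
  ring.
have Q0 : Q.[0] != 0.
  by rewrite /Q hornerD hornerN hornerM q0 mulr0 add0r oppr_eq0 horner_exp expf_neq0.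
have E'0 : ((- 27%:R * a ^+ 2)%:P * E).[0] != 0.
  have n27 : - 27%:R != 0 :> K by rewrite oppr_eq0 pnatr_eq0.
  by rewrite hornerM hornerC mulf_neq0 ?mulf_neq0 ?expf_neq0.
have sQ : (size Q <= n2.+1)%N.
  apply: size_add_le.
    apply: (@size_mul_le 0 n2) => //.
    by apply: (@size_mul_le 0 0) => //; [apply: size_natpoly_le|apply: size_const_le].
  by rewrite size_polyN expr2; apply: (size_mul_le sp sp); lia.
have sR : (size R <= b.+1)%N.
  have sc k : (size (k%:R * a%:P)%R <= 1)%N.
    by apply: (@size_mul_le 0 0) => //; [apply: size_natpoly_le|apply: size_const_le].
  apply: size_add_le; first apply: size_add_le.
  - apply: (@size_mul_le 0 (n1 + (n1 + n1))); first exact: size_natpoly_le.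
      rewrite exprS expr2; apply: (size_mul_le sp _ (leqnn _)).
      exact: (size_mul_le sp sp).
    lia.
  - rewrite size_polyN; apply: size_mul_le h2 => //.
    by apply: (size_mul_le (sc _) sp).
  - apply: (@size_mul_le 0 b) => //; rewrite -polyC_exp -polyC_natr -polyCM.
    exact: size_const_le.
by have := order_cube_square_le sQ sR Q0 m0 E'0 eD'; lia.
Qed.

End Discriminant.

(** * Moduli of complex numbers *)

Section Modulus.
Variable R : realType.
Implicit Types z w : Cplx R.

(** The norm of [Cplx R] takes values in [Cplx R], whose order is partial; its real part lies in the
    totally ordered field [R]. *)
Definition modulus (z : Cplx R) : R := complex.Re (`|z| : Cplx R).
Definition cst_of (x : R) : Cplx R := (x%:C)%C.

Lemma normE z : `|z| = cst_of (modulus z).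
Proof. by rewrite /modulus /cst_of RRe_real // normr_real. Qed.

Lemma cst_of_le (x y : R) : (cst_of x <= cst_of y) = (x <= y).
Proof. exact: lecR. Qed.

Lemma cst_of_lt (x y : R) : (cst_of x < cst_of y) = (x < y).
Proof. exact: ltcR. Qed.

Lemma cst_ofD (x y : R) : cst_of (x + y) = cst_of x + cst_of y.
Proof. exact: (rmorphD (real_complex R)). Qed.

Lemma cst_ofM (x y : R) : cst_of (x * y) = cst_of x * cst_of y.
Proof. exact: (rmorphM (real_complex R)). Qed.

Lemma cst_ofX (x : R) n : cst_of (x ^+ n) = cst_of x ^+ n.
Proof. exact: (rmorphXn (real_complex R)). Qed.

Lemma modulus_ge0 z : 0 <= modulus z.
Proof. by rewrite -cst_of_le -normE normr_ge0. Qed.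

Lemma modulusD z w : modulus (z + w) <= modulus z + modulus w.
Proof. by rewrite -cst_of_le cst_ofD -!normE ler_normD. Qed.

Lemma modulusM z w : modulus (z * w) = modulus z * modulus w.
Proof. by apply: (@complexI R); rewrite -!/(cst_of _) cst_ofM -!normE normrM. Qed.

Lemma modulusX z n : modulus (z ^+ n) = modulus z ^+ n.
Proof. by apply: (@complexI R); rewrite -!/(cst_of _) cst_ofX -!normE normrX. Qed.

Lemma modulusN z : modulus (- z) = modulus z.
Proof. by rewrite /modulus normrN. Qed.

Lemma modulusB z w : modulus (z - w) = modulus (w - z).
Proof. by rewrite -modulusN opprB. Qed.

Lemma modulus0 : modulus 0 = 0.
Proof. by rewrite /modulus normr0. Qed.

Lemma modulus_eq0 z : (modulus z == 0) = (z == 0).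
Proof.
apply/eqP/eqP => [h|->]; last exact: modulus0.
by apply/eqP; rewrite -normr_eq0 normE h.
Qed.

Lemma modulus_gt0 z : (0 < modulus z) = (z != 0).
Proof. by rewrite lt_def modulus_eq0 modulus_ge0 andbT. Qed.

Lemma modulus_real (x : R) : modulus (cst_of x) = `|x|.
Proof.
wlog x0 : x / 0 <= x.
  move=> h; have [/h //|xn] := leP 0 x.
  rewrite -modulusN -normrN -h ?oppr_ge0 1?ltW //; congr modulus.
  by rewrite /cst_of rmorphN.
apply: (@complexI R); rewrite -!/(cst_of _) -normE ger0_norm ?ger0_norm //.
by rewrite -[0]/(cst_of 0) cst_of_le.
Qed.

End Modulus.

(** * Orders along real parameters *)

Section Asymptotics.
Variable R : realType.
Local Notation C := (Cplx R).
Implicit Types (f g : R -> C) (n m : nat).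

(** [f(t) = O(t^n)] as [t] tends to [0] from the right. No regularity of [f] is asked, so arcs may
    be arbitrary functions. *)
Definition Opow n f := exists K d : R, [/\ 0 < K, 0 < d &
  forall t, 0 < t -> t < d -> modulus (f t) <= K * t ^+ n].

(** [f(t) = o(t^n)]. Its negation serves to say that an order is not larger than [n]. *)
Definition opow n f := forall e : R, 0 < e -> exists2 d : R, 0 < d &
  forall t, 0 < t -> t < d -> modulus (f t) <= e * t ^+ n.

Lemma eq_Opow n f g : f =1 g -> Opow n f -> Opow n g.
Proof. by move=> e; rewrite (_ : g = f) //; apply/funext => x; rewrite e. Qed.

Lemma eq_opow n f g : f =1 g -> opow n f -> opow n g.
Proof. by move=> e; rewrite (_ : g = f) //; apply/funext => x; rewrite e. Qed.

Lemma eq_Opow_near n f g (e : R) : 0 < e ->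
  (forall t, 0 < t -> t < e -> f t = g t) -> Opow n f -> Opow n g.
Proof.
move=> e0 fg [K [d [K0 d0 h]]]; exists K, (Num.min d e).
split; rewrite ?lt_min ?d0 // => t t0; rewrite lt_min => /andP[td te].
by rewrite -fg // h.
Qed.


Lemma Opow1_lt f (e : R) : Opow 1 f -> 0 < e ->
  exists2 d : R, 0 < d & forall t, 0 < t -> t < d -> modulus (f t) < e.
Proof.
move=> [K [d [K0 d0 h]]] e0; exists (Num.min d (e / K)).
  by rewrite lt_min d0 divr_gt0.
move=> t t0; rewrite lt_min => /andP[td te].
by rewrite (le_lt_trans (h _ t0 td)) // expr1 mulrC -ltr_pdivlMr.
Qed.

Lemma opow_lower_bound n f (c e : R) : 0 < c -> 0 < e ->
  (forall t, 0 < t -> t < e -> c * t ^+ n <= modulus (f t)) -> ~ opow n f.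
Proof.
move=> c0 e0 h hf; have [d d0 h'] := hf (c / 2) (divr_gt0 c0 (ltr0Sn _ _)).
pose t := Num.min d e / 2; have m0 : 0 < Num.min d e by rewrite lt_min d0.
have t0 : 0 < t by rewrite divr_gt0.
have tm : t < Num.min d e by rewrite ltr_pdivrMr // mulr_natr mulr2n ltrDl.
move: (tm); rewrite lt_min => /andP[td te].
have := le_trans (h t t0 te) (h' t t0 td); rewrite ler_pM2r ?exprn_gt0 //.
by rewrite leNgt ltr_pdivrMr // mulr_natr mulr2n ltrDl c0.
Qed.

Lemma OpowD n f g : Opow n f -> Opow n g -> Opow n (fun t => f t + g t).
Proof.
move=> [K [d [K0 d0 h]]] [K' [d' [K'0 d'0 h']]].
exists (K + K'), (Num.min d d'); split; rewrite ?addr_gt0 ?lt_min ?d0 //.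
move=> t t0; rewrite lt_min => /andP[td td'].
by rewrite (le_trans (modulusD _ _)) // mulrDl lerD ?h ?h'.
Qed.

Lemma OpowM n m f g : Opow n f -> Opow m g -> Opow (n + m) (fun t => f t * g t).
Proof.
move=> [K [d [K0 d0 h]]] [K' [d' [K'0 d'0 h']]].
exists (K * K'), (Num.min d d'); split; rewrite ?mulr_gt0 ?lt_min ?d0 //.
move=> t t0; rewrite lt_min => /andP[td td'].
by rewrite modulusM exprD mulrACA ler_pM ?modulus_ge0 ?h ?h'.
Qed.

Lemma Opow_cst (c : C) : Opow 0 (fun=> c).
Proof.
exists (modulus c + 1), 1; split => //; first by rewrite ltr_wpDl ?modulus_ge0.
by move=> t _ _; rewrite expr0 mulr1 lerDl.
Qed.

Lemma Opow_id : Opow 1 (@cst_of R).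
Proof.
exists 1, 1; split => // t t0 _.
by rewrite modulus_real mul1r expr1 gtr0_norm.
Qed.

Lemma OpowW n m f : (m <= n)%N -> Opow n f -> Opow m f.
Proof.
move=> mn [K [d [K0 d0 h]]]; exists K, (Num.min d 1).
split; rewrite ?lt_min ?d0 ?ltr01 //= => t t0; rewrite lt_min => /andP[td t1].
rewrite (le_trans (h _ t0 td)) // ler_pM2l //.
by rewrite ler_wiXn2l // ltW.
Qed.

Lemma OpowX n k f : Opow n f -> Opow (n * k) (fun t => f t ^+ k).
Proof.
move=> hf; elim: k => [|k IH]; first by rewrite muln0; apply: Opow_cst.
by rewrite mulnS; apply: eq_Opow (OpowM hf IH) => t; rewrite exprS.
Qed.

Lemma OpowZ n (c : C) f : Opow n f -> Opow n (fun t => c * f t).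
Proof. by move=> h; apply: (OpowM (Opow_cst c) h). Qed.

Lemma OpowN n f : Opow n f -> Opow n (fun t => - f t).
Proof. by move=> /(OpowZ (-1)); apply: eq_Opow => t; rewrite mulN1r. Qed.

Lemma OpowB n f g : Opow n f -> Opow n g -> Opow n (fun t => f t - g t).
Proof. by move=> hf /OpowN hg; apply: (OpowD hf hg). Qed.

Lemma Opow_horner (P : {poly C}) f : Opow 0 f -> Opow 0 (fun t => P.[f t]).
Proof.
move=> hf; elim/poly_ind: P => [|P c IH].
  by apply: eq_Opow (Opow_cst 0) => t; rewrite horner0.
apply: eq_Opow (OpowD (OpowM IH hf) (Opow_cst c)) => t.
by rewrite hornerMXaddC.
Qed.

Lemma Opow_divX n m f : Opow (n + m) (fun t => cst_of t ^+ n * f t) -> Opow m f.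
Proof.
move=> [K [d [K0 d0 h]]]; exists K, d; split => // t t0 td.
have := h t t0 td; rewrite modulusM modulusX modulus_real gtr0_norm // exprD.
by rewrite mulrCA ler_pM2l // exprn_gt0.
Qed.

Lemma Opow_opow n f : Opow n.+1 f -> opow n f.
Proof.
move=> [K [d [K0 d0 h]]] e e0; exists (Num.min d (e / K)).
  by rewrite lt_min d0 divr_gt0.
move=> t t0; rewrite lt_min => /andP[td te].
rewrite (le_trans (h _ t0 td)) // exprS mulrA ler_wpM2r ?exprn_ge0 ?ltW //.
by rewrite mulrC -ltr_pdivlMr.
Qed.

Lemma opowD n f g : opow n f -> opow n g -> opow n (fun t => f t + g t).
Proof.
move=> hf hg e e0; have e20 : 0 < e / 2 by rewrite divr_gt0.
have [d d0 h] := hf _ e20; have [d' d'0 h'] := hg _ e20.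
exists (Num.min d d'); first by rewrite lt_min d0.
move=> t t0; rewrite lt_min => /andP[td td'].
by rewrite (le_trans (modulusD _ _)) // [e]splitr mulrDl lerD ?h ?h'.
Qed.

Lemma opowZ n (c : C) f : opow n f -> opow n (fun t => c * f t).
Proof.
move=> hf e e0; have c1 : 0 < modulus c + 1 by rewrite ltr_wpDl ?modulus_ge0.
have [d d0 h] := hf (e / (modulus c + 1)) (divr_gt0 e0 c1).
exists d => // t t0 td; rewrite modulusM.
apply: (@le_trans _ _ ((modulus c + 1) * (e / (modulus c + 1) * t ^+ n))).
  by rewrite ler_pM ?modulus_ge0 ?h ?lerDl.
by rewrite mulrA mulrCA mulfV ?lt0r_neq0 // mulr1.
Qed.

Lemma opowZ_inv n (c : C) f : c != 0 -> opow n (fun t => c * f t) -> opow n f.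
Proof.
by move=> c0 /(opowZ c^-1); apply: eq_opow => t; rewrite mulKf.
Qed.

Lemma opow_expr_inv n k f : (0 < k)%N ->
  opow (n * k) (fun t => f t ^+ k) -> opow n f.
Proof.
move=> k0 hf e e0; have [d d0 h] := hf (e ^+ k) (exprn_gt0 _ e0).
exists d => // t t0 td; have := h t t0 td.
rewrite modulusX exprM -exprMn ler_pXn2r ?nnegrE ?modulus_ge0 //.
by rewrite mulr_ge0 ?exprn_ge0 // ltW.
Qed.

Lemma opowN n f : opow n f -> opow n (fun t => - f t).
Proof. by move=> /(opowZ (-1)); apply: eq_opow => t; rewrite mulN1r. Qed.

Lemma opow_cst0 n (c : C) : opow n (fun=> c) -> c = 0.
Proof.
move=> h; apply/eqP/negPn/negP => c0; have c1 : 0 < modulus c by rewrite modulus_gt0.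
have [d d0] := h (modulus c / 2) (divr_gt0 c1 (ltr0Sn _ _)).
pose t := Num.min 1 (d / 2); have t0 : 0 < t by rewrite lt_min ltr01 divr_gt0.
have t1 : t <= 1 by rewrite ge_min lexx.
have td : t < d by rewrite gt_min orbC ltr_pdivrMr // mulr_natr mulr2n ltrDl d0.
move=> /(_ t t0 td); rewrite leNgt => /negP; apply.
apply: (@le_lt_trans _ _ (modulus c / 2)).
  by rewrite ler_piMr ?divr_ge0 ?modulus_ge0 // exprn_ile1 // ltW.
by rewrite ltr_pdivrMr // mulr_natr mulr2n ltrDl.
Qed.

(** The remainder is polynomial in [x] and [h] jointly, hence bounded along bounded arcs. *)
Lemma horner_taylor2 (P : {poly C}) : exists H : {poly {poly C}},
  forall x h : C, P.[x + h] = P.[x] + h * P^`().[x] + h ^+ 2 * H.[h%:P].[x].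
Proof.
elim/poly_ind: P => [|P c [H IH]].
  by exists 0 => x h; rewrite deriv0 !horner0 !mulr0 !addr0.
exists (H * 'X%:P + H * 'X + (P^`())%:P) => x h.
rewrite derivD derivM derivX derivC addr0 mulr1 !hornerMXaddC IH.
rewrite !(hornerD, hornerM, hornerX, hornerC, hornerMX); ring.
Qed.

End Asymptotics.

(** * Analytic maps are locally Lipschitz *)

Section PowerSeries.

(** The mean value estimate with constant [n rho^(n-1)], multiplied by [rho] so that no exponent
    [n - 1] occurs. *)
Lemma dist_exp_le (K : numFieldType) (u v rho : K) n :
  `|u| <= rho -> `|v| <= rho ->
  `|u ^+ n - v ^+ n| * rho <= n%:R * rho ^+ n * `|u - v|.
Proof.
move=> hu hv; have rho0 : 0 <= rho := le_trans (normr_ge0 _) hu.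
elim: n => [|n IH]; first by rewrite !expr0 subrr normr0 !mul0r.
have -> : u ^+ n.+1 - v ^+ n.+1 = u * (u ^+ n - v ^+ n) + (u - v) * v ^+ n.
  by rewrite !exprS; ring.
apply: le_trans (ler_wpM2r rho0 (ler_normD _ _)) _.
rewrite mulrDl !normrM -natr1 !mulrDl mul1r lerD //.
  rewrite -mulrA (le_trans (ler_pM _ _ hu IH)) ?mulr_ge0 //.
  by rewrite exprS !mulrA ![_ * rho]mulrC.
rewrite -mulrA mulrC ler_wpM2r // exprSr ler_wpM2r //.
by rewrite normrX lerXn2r ?nnegrE.
Qed.

Variable R : realType.
Local Notation C := (Cplx R).

Definition size1 (h : C * C) : R := modulus h.1 + modulus h.2.

(** The power series is estimated term by term on a smaller polydisc: the partial sums satisfy a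
    common Lipschitz bound, which passes to the limit. *)
Lemma analytic_at_lipschitz (f : C * C -> C) (p : C * C) : analytic_at f p ->
  exists K d : R, [/\ 0 < K, 0 < d & forall h h', size1 h < d -> size1 h' < d ->
    modulus (f (p + h) - f (p + h')) <= K * size1 (h - h')].
Proof.
move=> [c [r [M [r0 hM hcv]]]].
(* Halving the radius absorbs the factor [i] of the mean value estimate:
   [i rho^i <= (2 rho)^i = r^i], and [M] bounds the resulting sums. *)
set rho : C := r / 2%:R.
have rho0 : 0 < rho by rewrite divr_gt0 // ltr0n.
have er : r = 2%:R * rho by rewrite mulrC divfK // pnatr_eq0.
have M0 : 0 <= M by have := hM 0; rewrite big_ord0.
have real_of (x : C) : 0 <= x -> x = cst_of (modulus x).
  by move=> x0; rewrite -normE ger0_norm.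
have [rhoR MR] : rho = cst_of (modulus rho) /\ M = cst_of (modulus M).
  by split; apply: real_of => //; apply: ltW.
have mrho : 0 < modulus rho by rewrite modulus_gt0 gt_eqF.
exists (modulus M / modulus rho + 1), (modulus rho); split => //.
  by rewrite ltr_wpDl ?divr_ge0 ?modulus_ge0.
move=> [u v] [u' v']; rewrite /size1 /= => huv huv'.
rewrite -[p + (u, v)]/(p.1 + u, p.2 + v) -[p + (u', v')]/(p.1 + u', p.2 + v').
have bnd (x : C) : modulus x < modulus rho -> `|x| <= rho.
  by move=> h; rewrite normE rhoR cst_of_le ltW.
have ge0 := @modulus_ge0 R.
have hu : `|u| <= rho by apply: bnd; apply: le_lt_trans huv; rewrite lerDl.
have hv : `|v| <= rho by apply: bnd; apply: le_lt_trans huv; rewrite lerDr.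
have hu' : `|u'| <= rho by apply: bnd; apply: le_lt_trans huv'; rewrite lerDl.
have hv' : `|v'| <= rho by apply: bnd; apply: le_lt_trans huv'; rewrite lerDr.
have rhor : rho < r by rewrite er mulr_natl mulr2n ltrDl.
pose S n (x y : C) : C := \sum_(i < n) \sum_(j < n) c i j * x ^+ i * y ^+ j.
set D := `|u - u'| + `|v - v'|.
have natexp (x : C) (k : nat) : 0 <= x -> k%:R * x ^+ k <= (2%:R * x) ^+ k.
  move=> x0; rewrite exprMn ler_wpM2r ?exprn_ge0 // -natrX ler_nat.
  by rewrite ltnW // ltn_expl.
have term i j : `|c i j * u ^+ i * v ^+ j - c i j * u' ^+ i * v' ^+ j| * rho
    <= `|c i j| * r ^+ (i + j) * D.
  have -> : c i j * u ^+ i * v ^+ j - c i j * u' ^+ i * v' ^+ j =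
      c i j * ((u ^+ i - u' ^+ i) * v ^+ j + u' ^+ i * (v ^+ j - v' ^+ j)).
    by ring.
  rewrite normrM -!mulrA ler_wpM2l //.
  apply: le_trans (ler_wpM2r (ltW rho0) (ler_normD _ _)) _.
  rewrite !normrM [leLHS]mulrDl /D mulrDr lerD //.
    rewrite [leLHS]mulrAC exprD [leRHS]mulrAC ler_pM ?mulr_ge0 ?(ltW rho0) ?(ltW r0) //.
      apply: le_trans (dist_exp_le _ hu hu') _; rewrite ler_wpM2r //.
      by rewrite er natexp // ltW.
    by rewrite normrX lerXn2r ?nnegrE ?(ltW r0) // (le_trans hv) ?(ltW rhor).
  rewrite -mulrA exprD -mulrA ler_pM ?mulr_ge0 ?(ltW rho0) ?(ltW r0) //.
    by rewrite normrX lerXn2r ?nnegrE ?(ltW r0) // (le_trans hu') ?(ltW rhor).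
  apply: le_trans (dist_exp_le _ hv hv') _; rewrite ler_wpM2r //.
  by rewrite er natexp // ltW.
have Sle n : `|S n u v - S n u' v'| * rho <= M * D.
  rewrite /S -sumrB; apply: le_trans (ler_wpM2r _ (hM n)); last first.
    by rewrite addr_ge0.
  apply: le_trans (ler_wpM2r (ltW rho0) (ler_norm_sum _ _ _)) _.
  rewrite !mulr_suml ler_sum // => i _; rewrite -sumrB.
  apply: le_trans (ler_wpM2r (ltW rho0) (ler_norm_sum _ _ _)) _.
  by rewrite !mulr_suml ler_sum // => j _; apply: term.
have lim (x y : C) (e : R) : `|x| <= rho -> `|y| <= rho -> 0 < e ->
    \forall n \near \oo, modulus (f (p.1 + x, p.2 + y) - S n x y) < e.
  move=> hx hy e0.
  have := hcv x y (le_lt_trans hx rhor) (le_lt_trans hy rhor).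
  have e0' : 0 < cst_of e by rewrite -[0]/(cst_of 0) cst_of_lt.
  move=> /cvgr_dist_lt /(_ _ e0'); apply: filterS => n.
  by rewrite normE cst_of_lt.
have main : modulus (f (p.1 + u, p.2 + v) - f (p.1 + u', p.2 + v')) <=
    modulus M / modulus rho * (modulus (u - u') + modulus (v - v')).
  apply/ler_addgt0Pr => e e0; have e20 : 0 < e / 2 by rewrite divr_gt0.
  have [n [h1 h2]] := filter_ex (filterI (lim u v _ hu hv e20) (lim u' v' _ hu' hv' e20)).
  move: h1 h2; set A := f _; set A' := f _ => h1 h2.
  have -> : A - A' = (A - S n u v) + (S n u v - S n u' v') + (S n u' v' - A').
    by ring.
  have h3 : modulus (S n u v - S n u' v') <=
      modulus M / modulus rho * (modulus (u - u') + modulus (v - v')).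
    rewrite mulrAC ler_pdivlMr // -cst_of_le !cst_ofM cst_ofD.
    by rewrite -!normE (gtr0_norm rho0) (ger0_norm M0); apply: Sle.
  rewrite modulusB in h2.
  have := modulusD (A - S n u v + (S n u v - S n u' v')) (S n u' v' - A').
  have := modulusD (A - S n u v) (S n u v - S n u' v').
  by lra.
apply: le_trans main _; rewrite ler_wpM2r ?addr_ge0 //.
by rewrite lerDl.
Qed.


Lemma size1_ge0 (h : C * C) : 0 <= size1 h.
Proof. by rewrite addr_ge0 ?modulus_ge0. Qed.

Lemma size1_0 : size1 0 = 0.
Proof. by rewrite /size1 /= modulus0 addr0. Qed.

Lemma size1D (h h' : C * C) : size1 (h + h') <= size1 h + size1 h'.
Proof. by rewrite /size1 /= addrACA lerD ?modulusD. Qed.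

Lemma modulus1_le (h : C * C) : modulus h.1 <= size1 h.
Proof. by rewrite lerDl modulus_ge0. Qed.

Lemma modulus2_le (h : C * C) : modulus h.2 <= size1 h.
Proof. by rewrite lerDr modulus_ge0. Qed.

Lemma analytic_map_lipschitz (f : C * C -> C * C) (p : C * C) :
  analytic_at (fun x => (f x).1) p -> analytic_at (fun x => (f x).2) p ->
  exists K d : R, [/\ 0 < K, 0 < d & forall h h', size1 h < d -> size1 h' < d ->
    size1 (f (p + h) - f (p + h')) <= K * size1 (h - h')].
Proof.
move=> /analytic_at_lipschitz[K [d [K0 d0 H]]].
move=> /analytic_at_lipschitz[K' [d' [K'0 d'0 H']]].
exists (K + K'), (Num.min d d'); split; rewrite ?addr_gt0 ?lt_min ?d0 //.
move=> h h'; rewrite !lt_min => /andP[hd hd'] /andP[h'd h'd'].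
by rewrite mulrDl lerD ?H ?H'.
Qed.

Lemma open_size1_ball (U : set (C * C)) (p : C * C) : open U -> U p ->
  exists2 d : R, 0 < d & forall h, size1 h < d -> U (p + h).
Proof.
move=> oU Up; have /nbhs_ballP[e e0 he] : nbhs p U by apply: open_nbhs_nbhs.
(* The radius of a ball is an element of [Cplx R], real because it is positive. *)
have e_real : e = cst_of (modulus e) by rewrite -normE gtr0_norm.
exists (modulus e) => [|h hd]; first by rewrite modulus_gt0 gt_eqF.
apply: he; split; rewrite /= -ball_normE /ball_ /= opprD addNKr normrN;
  rewrite normE e_real cst_of_lt.
  exact: le_lt_trans (modulus1_le _) hd.
exact: le_lt_trans (modulus2_le _) hd.
Qed.

End PowerSeries.

(** * The local model *)

Section LocalModel.
Variable R : realType.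
Local Notation C := (Cplx R).

(* All that is retained of an [A_k] singularity of [G = 0] at the origin: a
   bi-Lipschitz change of coordinates and a unit bounded away from [0] and
   infinity. *)
Definition Ak_model (G : C * C -> C) (k : nat) (Phi Psi : C * C -> C * C)
    (E : C * C -> C) (K d d' : R) : Prop :=
  [/\ [/\ 0 < K, 0 < d, 0 < d', Phi 0 = 0 & Psi 0 = 0],
      forall h, size1 h < d ->
        [/\ G h = E h * ((Phi h).2 ^+ 2 - (Phi h).1 ^+ k.+1),
            modulus (E h) <= K & 1 <= K * modulus (E h)],
      forall h h', size1 h < d -> size1 h' < d ->
        size1 (Phi h - Phi h') <= K * size1 (h - h'),
      forall q q', size1 q < d' -> size1 q' < d' ->
        size1 (Psi q - Psi q') <= K * size1 (q - q')
    & forall q, size1 q < d' -> size1 (Psi q) < d /\ Phi (Psi q) = q].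

(** Coordinates, inverse coordinates and unit are all Lipschitz near the base point, and the unit
    does not vanish there. *)
Lemma given_by_Ak_model (F : {poly {poly C}}) (s : C * C) (k : nat) :
  given_by_Ak_equation F s k ->
  exists Phi Psi E K d d',
    Ak_model (fun h => eval2 F (s + h)) k Phi Psi E K d d'.
Proof.
move=> [U [phi [e [[oU Us phis [V [psi [oV UV VU aphi apsi]]]] ae hF]]]].
have [[aphi1 aphi2] [apsi1 apsi2]] := (aphi, apsi).
have Vphi : V 0 by have [] := UV s Us; rewrite phis.
have psi0 : psi 0 = s by have [_] := UV s Us; rewrite phis.
have [K1 [d1 [K1_0 d1_0 H1]]] := analytic_map_lipschitz (aphi1 s Us) (aphi2 s Us).
have [K2 [d2 [K2_0 d2_0 H2]]] := analytic_map_lipschitz (apsi1 0 Vphi) (apsi2 0 Vphi).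
have [K3 [d3 [K3_0 d3_0 H3]]] := analytic_at_lipschitz (ae s Us).
have [d4 d4_0 H4] := open_size1_ball oU Us.
have [d5 d5_0 H5] := open_size1_ball oV Vphi.
have [es0 _] := hF s Us; rewrite -modulus_gt0 in es0.
set m := modulus (e s) in es0 *.
have m_inv : m * (2 / m) = 2 by rewrite mulrC divfK // gt_eqF.
have m_inv0 : 0 < 2 / m by rewrite divr_gt0.
(* One constant for everything: [K1] and [K2] are Lipschitz constants, [m + m] bounds the unit and
   [2 / m] its inverse. *)
pose K := K1 + K2 + m + m + 2 / m.
(* The bound [m / (2 * K3)] keeps the unit within [m / 2] of its value at [s]. *)
pose d := Num.min (Num.min d1 d4) (Num.min d3 (m / (2 * K3))).
have d_0 : 0 < d by rewrite !lt_min d1_0 d3_0 d4_0 divr_gt0 ?mulr_gt0.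
(* The bound [d / K2] makes [Psi] map the ball of radius [d'] into that of radius [d]. *)
pose d' := Num.min (Num.min d2 d5) (d / K2).
have d'_0 : 0 < d' by rewrite !lt_min d2_0 d5_0 divr_gt0.
exists (fun h => phi (s + h)), (fun q => psi q - s), (fun h => e (s + h)), K, d, d'.
split.
- by split; rewrite ?addr0 ?psi0 ?subrr // /K; lra.
- move=> h; rewrite !lt_min -andbA => /and4P[hd1 hd4 hd3 hdm].
  have [_ ->] := hF _ (H4 _ hd4).
  have : modulus (e (s + h) - e (s + 0)) < m / 2.
    apply: le_lt_trans (H3 h 0 hd3 _) _; first by rewrite size1_0.
    by move: hdm; rewrite subr0 invfM mulrA ltr_pdivlMr // mulrC.
  rewrite addr0 => he.
  have := modulusD (e (s + h) - e s) (e s); rewrite subrK => he1.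
  have := modulusD (e s - e (s + h)) (e (s + h)); rewrite subrK modulusB => he2.
  split=> //; first by rewrite /K -/m in he1 *; lra.
  have hm : m / 2 <= modulus (e (s + h)) by rewrite -/m in he2; lra.
  apply: (@le_trans _ _ (2 / m * (m / 2))).
    by rewrite mulrA divfK ?gt_eqF // divff.
  by rewrite ler_pM ?ltW ?divr_gt0 // /K; lra.
- move=> h h'; rewrite !lt_min -!andbA => /and4P[hd1 _ _ _] /and4P[hd1' _ _ _].
  apply: le_trans (H1 _ _ hd1 hd1') _.
  by rewrite ler_wpM2r ?size1_ge0 // /K; lra.
- move=> q q'; rewrite !lt_min -!andbA => /and3P[qd2 _ _] /and3P[qd2' _ _].
  have := H2 _ _ qd2 qd2'; rewrite !add0r opprB addrA subrK => h.
  by apply: le_trans h _; rewrite ler_wpM2r ?size1_ge0 // /K; lra.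
- move=> q qd'; have [qd2 qd5 qdd] : [/\ size1 q < d2, size1 q < d5 & size1 q < d / K2].
    by move: qd'; rewrite /d' !lt_min -andbA => /and3P[].
  have := H5 _ qd5; rewrite add0r => Vq.
  split; last by rewrite addrC subrK; have [] := VU _ Vq.
  have := H2 q 0 qd2; rewrite size1_0 !add0r psi0 subr0 => /(_ d2_0) h.
  have : K2 * size1 q < d by rewrite mulrC -ltr_pdivlMr.
  by apply: le_lt_trans.
Qed.

Variables (G : C * C -> C) (k : nat) (Phi Psi : C * C -> C * C)
  (E : C * C -> C) (K d d' : R).
Hypothesis M : Ak_model G k Phi Psi E K d d'.

Lemma Psi_arc (q : R -> C * C) (q0 : C * C) n (c : R) : size1 q0 < d' -> 0 < c ->
  (forall t, 0 < t -> size1 (q t - q0) <= c * t ^+ n.+1) ->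
  [/\ exists2 e : R, 0 < e & forall t, 0 < t -> t < e -> size1 (q t) < d',
      Opow n.+1 (fun t => (Psi (q t) - Psi q0).1)
    & Opow n.+1 (fun t => (Psi (q t) - Psi q0).2)].
Proof.
case: M => [[K0 d0 d'0 Phi0 Psi0] _ _ HPsi _] q0d c0 hq.
pose e := Num.min 1 ((d' - size1 q0) / c).
have e0 : 0 < e by rewrite lt_min ltr01 divr_gt0 // subr_gt0.
have qd t : 0 < t -> t < e -> size1 (q t) < d'.
  move=> t0; rewrite lt_min ltr_pdivlMr // => /andP[t1 te].
  have := size1D (q t - q0) q0; rewrite subrK.
  have : t ^+ n.+1 <= t by rewrite exprS ler_piMr ?exprn_ile1 ?ltW.
  have := hq t t0; move: te; rewrite mulrC => te h1 h2.
  have : c * t ^+ n.+1 <= c * t by rewrite ler_wpM2l // ltW.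
  by lra.
have bd t : 0 < t -> t < e -> size1 (Psi (q t) - Psi q0) <= K * c * t ^+ n.+1.
  move=> t0 te; apply: le_trans (HPsi _ _ (qd t t0 te) q0d) _.
  by rewrite -mulrA ler_pM2l // hq.
split; [by exists e | |]; exists (K * c), e; split; rewrite ?mulr_gt0 //.
  by move=> t t0 te; apply: le_trans (modulus1_le _) (bd t t0 te).
by move=> t t0 te; apply: le_trans (modulus2_le _) (bd t t0 te).
Qed.

(** The arc is the image under [Psi] of [(t^2, 0)]. A shift by [g] moves the coordinates by
    [O(t^(k+1))], so [y^2] and [x^(k+1)] both remain [O(t^(2(k+1)))]. *)
Lemma Ak_square_arc : (0 < k)%N -> exists xi eta : R -> C,
  [/\ Opow 2 xi, Opow 2 eta, ~ (opow 2 xi /\ opow 2 eta)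
    & forall g : R -> C * C, (forall t, 0 < t -> size1 (g t) <= t ^+ k.+1) ->
      Opow (k.+1 * 2) (fun t => G ((xi t, eta t) + g t))].
Proof.
case: M => [[K0 d0 d'0 Phi0 Psi0] HG HPhi HPsi HPP] k0.
pose q (t : R) : C * C := (cst_of t ^+ 2, 0).
have sq t : size1 (q t) = t ^+ 2.
  by rewrite /size1 /= modulus0 addr0 modulusX modulus_real real_normK ?num_real.
have [|||[e e0 qd] O1 O2] := @Psi_arc q 0 1 1; rewrite ?size1_0 //.
  by move=> t t0; rewrite subr0 sq mul1r.
rewrite Psi0 in O1 O2.
have {O1} O1 : Opow 2 (fun t => (Psi (q t)).1).
  by apply: eq_Opow O1 => t; rewrite subr0.
have {O2} O2 : Opow 2 (fun t => (Psi (q t)).2).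
  by apply: eq_Opow O2 => t; rewrite subr0.
exists (fun t => (Psi (q t)).1), (fun t => (Psi (q t)).2); split => //.
  move=> [ho1 ho2].
  (* As [Phi] is Lipschitz, [t^2] is at most [K] times the size of the arc. *)
  apply: (@opow_lower_bound R 2 (fun t => cst_of (size1 (Psi (q t)))) K^-1 e) => //.
  - by rewrite invr_gt0.
  - move=> t t0 te; rewrite modulus_real ger0_norm ?size1_ge0 //.
    rewrite mulrC ler_pdivrMr // mulrC -sq.
    have [s1 s2] := HPP _ (qd t t0 te).
    by have := HPhi (Psi (q t)) 0 s1; rewrite size1_0 s2 Phi0 !subr0; apply.
  - move=> c c0; have c20 : 0 < c / 2 by rewrite divr_gt0.
    have [e1 e10 h1] := ho1 _ c20; have [e2 e20 h2] := ho2 _ c20.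
    exists (Num.min e1 e2); first by rewrite lt_min e10.
    move=> t t0; rewrite lt_min => /andP[te1 te2].
    rewrite modulus_real ger0_norm ?size1_ge0 //.
    by have := h1 t t0 te1; have := h2 t t0 te2; rewrite /size1; lra.
move=> g hg; pose h t := Psi (q t) + g t.
have Og : Opow k.+1 (fun t => cst_of (size1 (g t))).
  exists 1, 1; split => // t t0 _.
  by rewrite modulus_real ger0_norm ?size1_ge0 // mul1r hg.
have Oq : Opow 2 (fun t => (q t).1).
  by apply: eq_Opow (OpowX 2 (@Opow_id R)) => t.
have [e3 e30 he3] : exists2 e3 : R, 0 < e3 & forall t, 0 < t -> t < e3 ->
    size1 (Psi (q t)) < d /\ size1 (h t) < d.
  have d30 : 0 < d / 3%:R by rewrite divr_gt0.
  have [e1 e10 h1] := Opow1_lt (OpowW (ltnW (ltnSn 1)) O1) d30.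
  have [e2 e20 h2] := Opow1_lt (OpowW (ltnW (ltnSn 1)) O2) d30.
  have [e4 e40 h4] := Opow1_lt (OpowW (ltn0Sn k) Og) d30.
  exists (Num.min (Num.min e1 e2) e4); first by rewrite !lt_min e10 e20.
  move=> t t0; rewrite !lt_min -andbA => /and3P[te1 te2 te4].
  have := h4 t t0 te4; rewrite modulus_real ger0_norm ?size1_ge0 // => lt4.
  have lt12 : size1 (Psi (q t)) < d / 3%:R + d / 3%:R.
    by rewrite /size1 ltrD ?h1 ?h2.
  by have := size1D (Psi (q t)) (g t); rewrite -/(h t) => *; split; lra.
pose f t := Phi (h t) - q t.
have e'0 : 0 < Num.min e e3 by rewrite lt_min e0.
have fle t : 0 < t -> t < Num.min e e3 -> size1 (f t) <= K * t ^+ k.+1.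
  move=> t0; rewrite lt_min => /andP[te te3]; have [s1 s2] := HPP _ (qd t t0 te).
  have [s3 s4] := he3 t t0 te3.
  have := HPhi (h t) (Psi (q t)) s4 s3; rewrite s2 -/(f t) /h addrC addKr.
  by move=> /le_trans; apply; rewrite ler_pM2l // hg.
have Of1 : Opow k.+1 (fun t => (f t).1).
  exists K, (Num.min e e3); split => // t t0 te.
  exact: le_trans (modulus1_le _) (fle t t0 te).
have Of2 : Opow k.+1 (fun t => (f t).2).
  exists K, (Num.min e e3); split => // t t0 te.
  exact: le_trans (modulus2_le _) (fle t t0 te).
(* Since [k >= 1], the shift of order [k + 1] is also [O(t^2)]. *)
have OPhi1 : Opow 2 (fun t => (Phi (h t)).1).
  apply: eq_Opow (OpowD (OpowW _ Of1) Oq) => // t.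
  by rewrite /f /= subrK.
have OPhi2 : Opow k.+1 (fun t => (Phi (h t)).2).
  by apply: eq_Opow Of2 => t; rewrite /f /= subr0.
have OE : Opow 0 (fun t => E (h t)).
  exists K, e3; split => // t t0 te; rewrite expr0 mulr1.
  by have [_ /HG[]] := he3 t t0 te.
have O3 : Opow (k.+1 * 2) (fun t => (Phi (h t)).2 ^+ 2 - (Phi (h t)).1 ^+ k.+1).
  by apply: OpowB; [apply: OpowX | rewrite mulnC; apply: OpowX].
apply: (eq_Opow_near e30 _ (OpowM OE O3)) => t t0 te.
by have [_ /HG[-> _ _]] := he3 t t0 te.
Qed.

(** On the image of [(0, t)] the model equation is [t^2]: the multiplicity at the origin is at most
    two. *)
Lemma Ak_transverse_arc : exists xi eta : R -> C,
  [/\ Opow 1 xi, Opow 1 eta & ~ opow 2 (fun t => G (xi t, eta t))].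
Proof.
case: M => [[K0 d0 d'0 Phi0 Psi0] HG HPhi HPsi HPP].
pose q (t : R) : C * C := (0, cst_of t).
have [|||[e e0 qd] O1 O2] := @Psi_arc q 0 0 1; rewrite ?size1_0 //.
  move=> t t0; rewrite subr0 /size1 /= modulus0 add0r modulus_real.
  by rewrite gtr0_norm // mul1r.
rewrite Psi0 in O1 O2.
exists (fun t => (Psi (q t)).1), (fun t => (Psi (q t)).2); split.
- by apply: eq_Opow O1 => t; rewrite subr0.
- by apply: eq_Opow O2 => t; rewrite subr0.
apply: (@opow_lower_bound R _ _ K^-1 e) => // [|t t0 te]; first by rewrite invr_gt0.
have [s1 s2] := HPP _ (qd t t0 te); rewrite -surjective_pairing.
have [-> _ KE] := HG _ s1; rewrite s2 expr0n subr0 modulusM modulusX.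
rewrite modulus_real gtr0_norm // ler_wpM2r ?exprn_ge0 ?(ltW t0) //.
by rewrite -[leLHS]mulr1 -(ler_pM2l K0) mulrA mulfV ?gt_eqF // mul1r.
Qed.

(** The point [(a^2, a^(k+1))] lies on the model curve, and raising its second coordinate by [t]
    changes the equation by [t (2 a^(k+1) + t)]. Failure of [o(t)] along this arc expresses
    smoothness without derivatives of the coordinates. *)
Lemma Ak_smooth_zeros (r : R) : 0 < r -> exists h : C * C,
  [/\ size1 h < r, G h = 0 & exists xi eta : R -> C,
    [/\ Opow 1 xi, Opow 1 eta & ~ opow 1 (fun t => G (h + (xi t, eta t)))]].
Proof.
case: M => [[K0 d0 d'0 Phi0 Psi0] HG HPhi HPsi HPP] r0.
pose m := Num.min 1 (Num.min d' (r / K)).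
have m0 : 0 < m by rewrite !lt_min ltr01 d'0 divr_gt0.
have [m1 md' mr] : [/\ m <= 1, m <= d' & m <= r / K].
  by split; rewrite /m !ge_min lexx ?orbT.
(* With this choice [a^2 + a^(k+1) <= 2 a < m], as [a <= 1]. *)
pose a := m / 4%:R; have a0 : 0 < a by rewrite divr_gt0.
have am : a *+ 4 = m by rewrite -mulr_natr divfK.
have a1 : a <= 1 by move: am; rewrite -mulr_natr; lra.
have ale n : a ^+ n.+1 <= a by rewrite exprS ler_piMr ?exprn_ile1 // ltW.
have age n : 0 < a ^+ n by rewrite exprn_gt0.
pose q0 : C * C := (cst_of (a ^+ 2), cst_of (a ^+ k.+1)).
pose q t : C * C := (cst_of (a ^+ 2), cst_of (a ^+ k.+1 + t)).
have sq0 : size1 q0 < m.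
  rewrite /size1 /= !modulus_real !gtr0_norm //.
  have := ale 1; have := ale k; move: am; rewrite -mulr_natr; lra.
have [|||[e e0 qd] O1 O2] := @Psi_arc q q0 0 1; rewrite ?(lt_le_trans sq0) //.
  move=> t t0; rewrite /size1 /= subrr modulus0 add0r cst_ofD addrAC subrr add0r.
  by rewrite modulus_real gtr0_norm // mul1r.
have [s1 s2] := HPP _ (lt_le_trans sq0 md').
exists (Psi q0); split.
- have := HPsi q0 0 (lt_le_trans sq0 md'); rewrite size1_0 Psi0 !subr0 => /(_ d'0).
  move=> /le_lt_trans; apply; rewrite mulrC -ltr_pdivlMr //.
  exact: lt_le_trans sq0 mr.
- have [-> _ _] := HG _ s1; rewrite s2 /= -!cst_ofX -!exprM mulnC subrr.
  by rewrite mulr0.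
exists (fun t => (Psi (q t) - Psi q0).1), (fun t => (Psi (q t) - Psi q0).2).
split => //; apply: (@opow_lower_bound R _ _ (a ^+ k.+1 / K) e) => //.
  by rewrite divr_gt0.
move=> t t0 te; rewrite -surjective_pairing addrC subrK.
have [s3 s4] := HPP _ (qd t t0 te); have [-> _ KE] := HG _ s3.
have -> : (Phi (Psi (q t))).2 ^+ 2 - (Phi (Psi (q t))).1 ^+ k.+1 =
    cst_of (t * (2%:R * a ^+ k.+1 + t)).
  rewrite s4 /= -!cst_ofX -exprM [(2 * _)%N]mulnC exprM.
  rewrite (_ : t * _ = (a ^+ k.+1 + t) ^+ 2 - (a ^+ k.+1) ^+ 2); last by ring.
  by rewrite /cst_of rmorphB.
have ak0 := age k.+1; rewrite expr1 modulusM modulus_real.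
have pos : 0 < 2%:R * a ^+ k.+1 + t by rewrite addr_gt0 ?mulr_gt0.
rewrite gtr0_norm ?mulr_gt0 //.
have KE' : K^-1 <= modulus (E (Psi (q t))).
  by rewrite -[leLHS]mulr1 -(ler_pM2l K0) mulrA mulfV ?gt_eqF // mul1r.
have le2 : t * a ^+ k.+1 <= t * (2%:R * a ^+ k.+1 + t) by rewrite ler_pM2l //; lra.
rewrite mulrAC mulrC [a ^+ k.+1 * t]mulrC.
by rewrite ler_pM // ?invr_ge0 ?mulr_ge0 ?(ltW K0) ?(ltW t0) ?(ltW ak0).
Qed.

End LocalModel.

(** * Cubics with an A_k singularity at the origin *)

Section CubicModel.
Variable R : realType.
Local Notation C := (Cplx R).

Lemma Opow_horner2 (H : {poly {poly C}}) (f g : R -> C) :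
  Opow 0 f -> Opow 0 g -> Opow 0 (fun t => H.[(f t)%:P].[g t]).
Proof.
move=> hf hg; elim/poly_ind: H => [|H c IH].
  by apply: eq_Opow (Opow_cst 0) => t; rewrite !horner0.
apply: eq_Opow (OpowD (OpowM IH hf) (Opow_horner c hg)) => t.
by rewrite hornerMXaddC hornerD hornerM hornerC.
Qed.

Lemma horner_expand2 (K : fieldType) (P : {poly K}) : exists P2 : {poly K},
  P = (P.[0])%:P + P^`().[0] *: 'X + 'X^2 * P2 /\
  forall v, P.[v] = P.[0] + P^`().[0] * v + v ^+ 2 * P2.[v] /\
    P^`().[v] = P^`().[0] + v * (2%:R * P2.[v] + v * P2^`().[v]).
Proof.
have eP : P = (P.[0])%:P + P^`().[0] *: 'X + 'X^2 * drop_poly 2 P.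
  rewrite -[LHS](poly_take_drop 2) [_ * 'X^2]mulrC.
  congr (_ + _); apply/polyP => -[|[|i]]; rewrite !horner_coef0 coef_deriv mulr1n;
  by rewrite coef_take_poly !(coefD, coefC, coefZ, coefX) /= ?mulr0 ?mulr1 ?addr0 ?add0r.
exists (drop_poly 2 P); split => // v; split.
  by rewrite {1}eP !(hornerD, hornerM, hornerZ, hornerC, hornerX, hornerXn).
rewrite {1}eP !(derivD, derivC, derivZ, derivX, derivM, derivXn) /= expr1.
rewrite !(hornerD, hornerM, hornerZ, hornerC, hornerX, hornerXn, hornerMn); ring.
Qed.

Definition cubic (a : C) (p q r : {poly C}) (h : C * C) : C :=
  a * h.1 ^+ 3 + p.[h.2] * h.1 ^+ 2 + q.[h.2] * h.1 + r.[h.2].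

Variables (a : C) (p q r : {poly C}).

Definition cubic_dx (u v : C) : C :=
  3%:R * a * u ^+ 2 + 2%:R * p.[v] * u + q.[v].
Definition cubic_dy (u v : C) : C :=
  p^`().[v] * u ^+ 2 + q^`().[v] * u + r^`().[v].

Ltac Opow0_tac := repeat first [assumption | exact: Opow_cst | apply: Opow_horner2
  | apply: Opow_horner | apply: OpowD | apply: OpowN
  | apply: (@OpowX R 0) | apply: (@OpowM R 0 0)].

Lemma cubic_taylor (u v x y : R -> C) :
  Opow 0 u -> Opow 0 v -> Opow 0 x -> Opow 0 y ->
  exists A B D : R -> C, [/\ Opow 0 A, Opow 0 B, Opow 0 D & forall t,
    cubic a p q r ((u t, v t) + (x t, y t)) = cubic a p q r (u t, v t)
     + x t * cubic_dx (u t) (v t) + y t * cubic_dy (u t) (v t)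
     + x t ^+ 2 * A t + x t * y t * B t + y t ^+ 2 * D t].
Proof.
move=> Ou Ov Ox Oy.
have [Hp ep] := horner_taylor2 p; have [Hq eq] := horner_taylor2 q.
have [Hr er] := horner_taylor2 r.
exists (fun t => 3%:R * a * u t + p.[v t] + a * x t).
exists (fun t => p^`().[v t] * (2%:R * u t + x t) + q^`().[v t]).
exists (fun t => Hp.[(y t)%:P].[v t] * (u t + x t) ^+ 2
  + Hq.[(y t)%:P].[v t] * (u t + x t) + Hr.[(y t)%:P].[v t]).
split; [by Opow0_tac | by Opow0_tac | by Opow0_tac |] => t.
by rewrite /cubic /cubic_dx /cubic_dy /= ep eq er; ring.
Qed.

Variables (k : nat) (Phi Psi : C * C -> C * C) (E : C * C -> C) (K d d' : R).
Hypothesis k0 : (0 < k)%N.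
Hypothesis M : Ak_model (cubic a p q r) k Phi Psi E K d d'.

(** Shifting the arc by [w = t^(k+1)] along one axis and subtracting gives
    [w G_u + w^2 A = O(t^(2(k+1)))], and likewise for [G_v]; dividing by [w] bounds the partial
    derivatives. *)
Lemma cubic_square_arc : exists xi eta : R -> C,
  [/\ Opow 2 xi, Opow 2 eta, ~ (opow 2 xi /\ opow 2 eta) &
   [/\ Opow (k.+1 * 2) (fun t => cubic a p q r (xi t, eta t)),
      Opow k.+1 (fun t => cubic_dx (xi t) (eta t))
    & Opow k.+1 (fun t => cubic_dy (xi t) (eta t))]].
Proof.
have [xi [eta [ O1 O2 no Og]]] := Ak_square_arc M k0.
exists xi, eta; split => //.
have xi0 : Opow 0 xi by apply: OpowW O1.
have eta0 : Opow 0 eta by apply: OpowW O2.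
have z0 : Opow 0 (fun _ : R => (0 : C)) by exact: Opow_cst.
pose w (t : R) : C := cst_of t ^+ k.+1.
have Ow : Opow k.+1 w.
  by have := OpowX k.+1 (@Opow_id R); rewrite mul1n.
have Ow0 : Opow 0 w by apply: OpowW Ow.
have mw t : 0 < t -> modulus (w t) = t ^+ k.+1.
  by move=> t0; rewrite modulusX modulus_real gtr0_norm.
have Oc : Opow (k.+1 * 2) (fun t => cubic a p q r (xi t, eta t)).
  apply: eq_Opow (Og (fun=> 0) _) => t; first by rewrite addr0.
  by move=> t0; rewrite size1_0 exprn_ge0 ?ltW.
split => //.
  have [A [B [D [ OA _ _ e]]]] := cubic_taylor xi0 eta0 Ow0 z0.
  have O3 : Opow (k.+1 * 2) (fun t => cubic a p q r ((xi t, eta t) + (w t, 0))).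
    apply: Og => t t0; rewrite /size1 /= modulus0 addr0 mw //.
  have /Opow_divX O4 : Opow (k.+1 + k.+1) (fun t => cst_of t ^+ k.+1 *
      (cubic_dx (xi t) (eta t) + w t * A t)).
    rewrite addnn -muln2; apply: eq_Opow (OpowB O3 Oc) => t.
    by rewrite e /w; ring.
  have OwA := OpowM Ow OA; rewrite addn0 in OwA.
  by apply: eq_Opow (OpowB O4 OwA) => t; ring.
have [A [B [D [_ _ OD e]]]] := cubic_taylor xi0 eta0 z0 Ow0.
have O3 : Opow (k.+1 * 2) (fun t => cubic a p q r ((xi t, eta t) + (0, w t))).
  apply: Og => t t0; rewrite /size1 /= modulus0 add0r mw //.
have /Opow_divX O4 : Opow (k.+1 + k.+1) (fun t => cst_of t ^+ k.+1 *
    (cubic_dy (xi t) (eta t) + w t * D t)).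
  rewrite addnn -muln2; apply: eq_Opow (OpowB O3 Oc) => t.
  by rewrite e /w; ring.
have OwD := OpowM Ow OD; rewrite addn0 in OwD.
by apply: eq_Opow (OpowB O4 OwD) => t; ring.
Qed.

(** A smooth zero of size less than [t] is chosen for each [t > 0]. Were both partial derivatives
    zero there, the Taylor expansion would make the cubic [O(s^2)] along the arc of
    [Ak_smooth_zeros]. *)
Lemma cubic_smooth_zeros : exists xi eta : R -> C,
  [/\ Opow 1 xi, Opow 1 eta & forall t, 0 < t ->
    cubic a p q r (xi t, eta t) = 0 /\
    ~ (cubic_dx (xi t) (eta t) = 0 /\ cubic_dy (xi t) (eta t) = 0)].
Proof.
have /choice[h Hh] : forall t : R, exists h : C * C, 0 < t ->
    [/\ size1 h < t, cubic a p q r h = 0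
      & ~ (cubic_dx h.1 h.2 = 0 /\ cubic_dy h.1 h.2 = 0)].
  move=> t; have [t0|tn] := ltP 0 t; last by exists 0.
  have [h [hs h0 [xi [eta [ O1 O2 no]]]]] := Ak_smooth_zeros M t0.
  exists h => _; split => // -[dx0 dy0]; apply: no; apply: Opow_opow.
  have xi0 : Opow 0 xi by apply: OpowW O1.
  have eta0 : Opow 0 eta by apply: OpowW O2.
  have [A [B [D [ OA OB OD e]]]] :=
    cubic_taylor (Opow_cst h.1) (Opow_cst h.2) xi0 eta0.
  have O3 := OpowM (OpowX 2 O1) OA; have O4 := OpowM (OpowM O1 O2) OB.
  have O5 := OpowM (OpowX 2 O2) OD.
  apply: eq_Opow (OpowD (OpowD O3 O4) O5) => s.
  by have := e s; rewrite -surjective_pairing h0 dx0 dy0 => ->; ring.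
exists (fun t => (h t).1), (fun t => (h t).2); split.
- exists 1, 1; split => // t t0 _; rewrite mul1r expr1.
  by have [/ltW/(le_trans (modulus1_le _))] := Hh t t0.
- exists 1, 1; split => // t t0 _; rewrite mul1r expr1.
  by have [/ltW/(le_trans (modulus2_le _))] := Hh t t0.
by move=> t t0; have [_] := Hh t t0; rewrite -surjective_pairing.
Qed.

End CubicModel.

(** * Limits with a linear rate *)

Section Converges.
Variable R : realType.
Local Notation C := (Cplx R).
Implicit Types f g : R -> C.

(** Convergence at rate [O(t)]: every limit below has this rate, so limits reduce to the calculus of
    [Opow]. *)
Definition converges f (c : C) := Opow 1 (fun t => f t - c).

Lemma converges_Opow0 f c : converges f c -> Opow 0 f.
Proof.
move=> hf; apply: eq_Opow (OpowD (OpowW (leq0n 1) hf) (Opow_cst c)) => t.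
by rewrite subrK.
Qed.

Lemma Opow_0 n : Opow n (fun=> 0 : C).
Proof.
by exists 1, 1; split => // t t0 _; rewrite modulus0 mul1r exprn_ge0 ?ltW.
Qed.

Lemma converges_cst c : converges (fun=> c) c.
Proof. by apply: eq_Opow (Opow_0 1) => t; rewrite subrr. Qed.

Lemma convergesD f g c e : converges f c -> converges g e ->
  converges (fun t => f t + g t) (c + e).
Proof. by move=> hf hg; apply: eq_Opow (OpowD hf hg) => t; ring. Qed.

Lemma convergesN f c : converges f c -> converges (fun t => - f t) (- c).
Proof. by move=> hf; apply: eq_Opow (OpowN hf) => t; ring. Qed.

Lemma convergesM f g c e : converges f c -> converges g e ->
  converges (fun t => f t * g t) (c * e).
Proof.
move=> hf hg; have h1 := OpowM hf (converges_Opow0 hg).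
by apply: eq_Opow (OpowD h1 (OpowZ c hg)) => t; ring.
Qed.

Lemma convergesX f c n : converges f c -> converges (fun t => f t ^+ n) (c ^+ n).
Proof.
move=> hf; elim: n => [|n IH]; first exact: converges_cst.
by apply: eq_Opow (convergesM hf IH) => t; rewrite !exprS.
Qed.

Lemma converges_horner (P : {poly C}) f c :
  converges f c -> converges (fun t => P.[f t]) P.[c].
Proof.
move=> hf; elim/poly_ind: P => [|P e IH].
  by apply: eq_Opow (converges_cst 0) => t; rewrite !horner0.
apply: eq_Opow (convergesD (convergesM IH hf) (converges_cst e)) => t.
by rewrite !hornerMXaddC.
Qed.

Lemma converges_Opow1 f : Opow 1 f -> converges f 0.
Proof. by apply: eq_Opow => t; rewrite subr0. Qed.

Lemma converges_Opow1_eq0 f c : Opow 1 f -> converges f c -> c = 0.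
Proof.
move=> hf hc; apply: (@opow_cst0 _ 0); apply: Opow_opow.
by apply: eq_Opow (OpowB hf hc) => t; ring.
Qed.

End Converges.

Ltac converges_tac := repeat match goal with
  | |- converges (fun _ => ?c) _ => exact: (converges_cst c)
  | |- converges (fun t => @?f t + @?g t) _ => apply: (@convergesD _ f g)
  | |- converges (fun t => - @?f t) _ => apply: (@convergesN _ f)
  | |- converges (fun t => @?f t * @?g t) _ => apply: (@convergesM _ f g)
  | |- converges (fun t => @?f t ^+ ?n) _ => apply: (@convergesX _ f)
  | |- converges (fun t => horner ?P (@?f t)) _ =>
      apply: (@converges_horner _ P f)
  | |- converges _ _ => assumption
  end.

Lemma horner_expand1 (K : fieldType) (P : {poly K}) :
  exists P1 : {poly K}, forall v, P.[v] = P.[0] + v * P1.[v].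
Proof.
have [P2 [_ e]] := horner_expand2 P; exists ((P^`().[0])%:P + 'X * P2) => v.
by rewrite (e v).1 hornerD hornerM hornerC hornerX; ring.
Qed.

(** Evaluate the identity and its derivative at [v]. With [Q = G(u, .)] and [T = G_u(u, .)] it turns
    a vanishing discriminant into singular points. *)
Lemma singular_of_sum_square (K : fieldType) (P Q S T : {poly K}) (v : K) :
  P * Q + S * T ^+ 2 = 0 -> P.[v] != 0 -> S.[v] != 0 -> Q.[v] = 0 ->
  T.[v] = 0 /\ Q^`().[v] = 0.
Proof.
move=> e P0 S0 Q0; have e1 := congr1 (horner^~ v) e.
have e2 := congr1 (fun X : {poly K} => X^`().[v]) e; move: e1 e2 => /=.
rewrite expr2 deriv0 !(derivD, derivM) !(hornerD, hornerM) horner0 Q0 mulr0 add0r.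
move=> /eqP; rewrite mulf_eq0 (negPf S0) mulf_eq0 orbb => /eqP T0 /eqP.
by rewrite T0 !(mulr0, mul0r, addr0, add0r) mulf_eq0 (negPf P0) => /eqP.
Qed.

(** * The order of the discriminant, and the exceptional case [p(0) = 0] *)

Section CubicBound.
Variable R : realType.
Local Notation C := (Cplx R).
Variables (a : C) (p q r : {poly C}).
Variables (k : nat) (Phi Psi : C * C -> C * C) (E : C * C -> C) (K d d' : R).
Hypothesis k0 : (0 < k)%N.
Hypothesis M : Ak_model (cubic a p q r) k Phi Psi E K d d'.

(** The cubic and its partial derivatives tend to zero along the square arc, which tends to the
    origin. *)
Lemma cubic_singular_origin : [/\ q.[0] = 0, r.[0] = 0 & r^`().[0] = 0].
Proof.
have [xi [eta [ O1 O2 _ [ Oc Ox Oy]]]] := cubic_square_arc k0 M.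
have {O1} c1 : converges xi 0 by apply: converges_Opow1; apply: OpowW O1.
have {O2} c2 : converges eta 0 by apply: converges_Opow1; apply: OpowW O2.
split; rewrite -[LHS]add0r.
- apply: (converges_Opow1_eq0 (OpowW (ltn0Sn k) Ox)).
  rewrite (_ : 0 + _ = 3%:R * a * 0 ^+ 2 + 2%:R * p.[0] * 0 + q.[0]); last by ring.
  by rewrite /cubic_dx; converges_tac.
- apply: (converges_Opow1_eq0 (OpowW _ Oc)) => //.
  rewrite (_ : 0 + _ = a * 0 ^+ 3 + p.[0] * 0 ^+ 2 + q.[0] * 0 + r.[0]); last by ring.
  by rewrite /cubic; converges_tac.
- apply: (converges_Opow1_eq0 (OpowW (ltn0Sn k) Oy)).
  rewrite (_ : 0 + _ = p^`().[0] * 0 ^+ 2 + q^`().[0] * 0 + r^`().[0]); last by ring.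
  by rewrite /cubic_dy; converges_tac.
Qed.

(* Smooth points of the curve accumulate at the origin. *)
Lemma vanishing_on_smooth_points (f : C -> C -> C) :
  (forall xi eta : R -> C, converges xi 0 -> converges eta 0 ->
    converges (fun t => f (xi t) (eta t)) (f 0 0)) ->
  (forall u v, cubic a p q r (u, v) = 0 ->
    ~ (cubic_dx a p q u v = 0 /\ cubic_dy p q r u v = 0) -> f u v = 0) ->
  f 0 0 = 0.
Proof.
move=> fc f0; have [xi [eta [ O1 O2 h]]] := cubic_smooth_zeros M.
apply: (converges_Opow1_eq0 _ (fc _ _ (converges_Opow1 O1) (converges_Opow1 O2))).
apply: (eq_Opow_near ltr01 _ (Opow_0 _ 1)) => t t0 _.
by have [h1 h2] := h t t0; rewrite f0.
Qed.

(** With [u] frozen, these are polynomials in [v] alone, and the formal derivative of [G u] is the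
    partial derivative in [v]. *)
Let A (u : C) : {poly C} :=
  27%:R * a%:P ^+ 2 * (a%:P * u%:P ^+ 3 + p * u%:P ^+ 2 + q * u%:P)
  - 4%:R * p ^+ 3 + 18%:R * a%:P * p * q - 27%:R * a%:P ^+ 2 * r.
Let B (u : C) : {poly C} :=
  p ^+ 2 - 4%:R * a%:P * q - 2%:R * a%:P * u%:P * p
  - 3%:R * a%:P ^+ 2 * u%:P ^+ 2.
Let G (u : C) : {poly C} :=
  a%:P * u%:P ^+ 3 + p * u%:P ^+ 2 + q * u%:P + r.
Let Gx (u : C) : {poly C} :=
  3%:R * a%:P * u%:P ^+ 2 + 2%:R * p * u%:P + q.

Let natC n : (n%:R : {poly C}) = (n%:R)%:P. Proof. by rewrite polyC_natr. Qed.

Let GE u v : (G u).[v] = cubic a p q r (u, v).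
Proof. by rewrite /G /cubic !(hornerD, hornerM, horner_exp, hornerC). Qed.

Let GxE u v : (Gx u).[v] = cubic_dx a p q u v.
Proof. by rewrite /Gx /cubic_dx !natC !(hornerD, hornerM, horner_exp, hornerC). Qed.

Let GyE u v : (G u)^`().[v] = cubic_dy p q r u v.
Proof.
rewrite /G /cubic_dy -!polyC_exp !(derivD, derivM, derivC).
by rewrite !(hornerD, hornerM, hornerC, horner0) !(mulr0, mul0r, add0r, addr0).
Qed.

(* If [x1, x2, x3] are the roots of the cubic in [u], then [B] takes the value
   [a^2 (x2 - x3)^2] at [u = x1]. *)
Let disc_in_ideal u : cubic_disc a p q r = A u * G u + B u * Gx u ^+ 2.
Proof. by rewrite /cubic_disc /A /B /G /Gx; ring. Qed.

Let discE u v : (cubic_disc a p q r).[v] =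
  (A u).[v] * (G u).[v] + (B u).[v] * (Gx u).[v] ^+ 2.
Proof.
rewrite (disc_in_ideal u); move: (A u) (B u) (G u) (Gx u) => P Q S T.
by rewrite hornerD 2!hornerM horner_exp.
Qed.

Lemma cubic_disc_neq0 : p.[0] != 0 -> cubic_disc a p q r != 0.
Proof.
move=> p0; apply/eqP => D0; have [q0 r0 _] := cubic_singular_origin.
(* Where this product is nonzero, a zero discriminant makes every zero of the cubic singular; so it
   vanishes at smooth zeros. At the origin it is [- 4 p(0)^5]. *)
pose f u v := (A u).[v] * (B u).[v].
have : f 0 0 = 0.
  apply: vanishing_on_smooth_points => [xi eta c1 c2|u v]; rewrite /f.
    rewrite /A /B !natC.
    under eq_fun do rewrite !(hornerD, hornerN, hornerM, horner_exp, hornerC).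
    rewrite !(hornerD, hornerN, hornerM, horner_exp, hornerC).
    by converges_tac.
  rewrite -GE -GxE -GyE => G0 nsm; apply/eqP/negPn/negP; rewrite mulf_eq0.
  rewrite negb_or => /andP[nA nB]; apply: nsm.
  have e : A u * G u + B u * Gx u ^+ 2 = 0 by rewrite -disc_in_ideal.
  exact: singular_of_sum_square e nA nB G0.
apply/eqP; rewrite /f /A /B !natC.
rewrite !(hornerD, hornerN, hornerM, horner_exp, hornerC) q0 r0.
rewrite mulf_neq0 //.
  rewrite (_ : _ + _ = - 4%:R * p.[0] ^+ 3); last by ring.
  by rewrite mulf_neq0 ?expf_neq0 ?oppr_eq0 ?pnatr_eq0.
by rewrite (_ : _ + _ = p.[0] ^+ 2) ?expf_neq0 //; ring.
Qed.

Lemma cubic_disc_order : (1 < k)%N -> p.[0] != 0 ->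
  exists (m : nat) (H : {poly C}),
    [/\ (k < m)%N, H.[0] != 0 & cubic_disc a p q r = 'X^m * H].
Proof.
move=> k1 p0; have [q0 r0 _] := cubic_singular_origin.
have [m [H H0 eD]] := multiplicity_XsubC (cubic_disc a p q r) 0.
rewrite (cubic_disc_neq0 p0) /= subr0 mulrC in H0 eD.
exists m, H; split => //; rewrite ltnNge; apply/negP => mk.
(* The discriminant vanishes at [0] because [q] and [r] do; a positive [m] is needed to extract
   [m]-th roots. *)
have m0 : (0 < m)%N.
  rewrite lt0n; apply: contraNneq H0 => m0; move: eD; rewrite m0 mul1r => <-.
  rewrite /root.
  rewrite /cubic_disc !natC !(hornerD, hornerN, hornerM, horner_exp, hornerC).
  by rewrite q0 r0; apply/eqP; ring.
have [xi [eta [ O1 O2 no [ Oc Ox _]]]] := cubic_square_arc k0 M.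
have c1 : converges xi 0 by apply: converges_Opow1; apply: OpowW O1.
have c2 : converges eta 0 by apply: converges_Opow1; apply: OpowW O2.
have eta0 := converges_Opow0 c2.
have OD : Opow (k.+1 * 2) (fun t => (cubic_disc a p q r).[eta t]).
  have cA : converges (fun t => (A (xi t)).[eta t]) (A 0).[0].
    rewrite /A !natC.
    under eq_fun do rewrite !(hornerD, hornerN, hornerM, horner_exp, hornerC).
    by rewrite !(hornerD, hornerN, hornerM, horner_exp, hornerC); converges_tac.
  have cB : converges (fun t => (B (xi t)).[eta t]) (B 0).[0].
    rewrite /B !natC.
    under eq_fun do rewrite !(hornerD, hornerN, hornerM, horner_exp, hornerC).
    by rewrite !(hornerD, hornerN, hornerM, horner_exp, hornerC); converges_tac.
  have OAG := OpowM (converges_Opow0 cA) Oc.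
  have OBG := OpowM (converges_Opow0 cB) (OpowX 2 Ox).
  apply: eq_Opow (OpowD OAG OBG) => t; rewrite -GE -GxE.
  by rewrite -(discE (xi t)).
(* If [m <= k], then [2 m + 1 <= 2 (k + 1)], so the leading term [H(0) eta^m] is [O(t^(2m+1))]. *)
have eta_small : opow 2 eta.
  apply: (@opow_expr_inv _ 2 m) => //; apply: (opowZ_inv H0); apply: Opow_opow.
  have [H2 [_ eH]] := horner_expand2 H.
  have OH2 := Opow_horner H2 eta0.
  have Orest := OpowM (OpowX m.+1 O2)
    (OpowD (Opow_cst H^`().[0]) (OpowM eta0 OH2)).
  have OD' : Opow (2 * m).+1 (fun t => (cubic_disc a p q r).[eta t]).
    by apply: OpowW OD; lia.
  have Orest' := OpowW (_ : (2 * m).+1 <= 2 * m.+1 + 0)%N Orest.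
  apply: eq_Opow (OpowB OD' (Orest' _)) => [t|]; last by lia.
  rewrite eD hornerM hornerXn (eH (eta t)).1 (exprS _ m) /=. ring.
apply: no; split => //.
(* [G_u] has linear part [2 p(0) xi + q'(0) eta], and all else is [O(t^3)] as [k >= 2]; hence [xi]
   is [o(t^2)] too. *)
have p0' : 2%:R * p.[0] != 0 by rewrite mulf_neq0 ?pnatr_eq0.
apply: (opowZ_inv p0').
have [p2 [_ ep]] := horner_expand2 p; have [q2 [_ eq]] := horner_expand2 q.
have O3 : Opow 3 (fun t => cubic_dx a p q (xi t) (eta t)) by apply: OpowW Ox.
have O4 : Opow 3 (fun t => 3%:R * a * xi t ^+ 2).
  by apply: OpowW (OpowZ _ (OpowX 2 O1)).
have Op := OpowD (Opow_cst p^`().[0]) (OpowM eta0 (Opow_horner p2 eta0)).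
have O5 : Opow 3 (fun t => 2%:R * ((eta t * xi t) *
    (p^`().[0] + eta t * p2.[eta t]))).
  by apply: OpowW (OpowZ _ (OpowM (OpowM O2 O1) Op)).
have O6 : Opow 3 (fun t => eta t ^+ 2 * q2.[eta t]).
  by apply: OpowW (OpowM (OpowX 2 O2) (Opow_horner q2 eta0)).
have o7 := opowN (opowZ q^`().[0] eta_small).
have o8 := Opow_opow (OpowB (OpowB (OpowB O3 O4) O5) O6).
apply: eq_opow (opowD o8 o7) => t.
by rewrite /cubic_dx (ep (eta t)).1 (eq (eta t)).1 q0; ring.
Qed.

(** Every term would have total degree at least three, so the cubic would be [O(t^3)] along the
    transverse arc. *)
Lemma cubic_no_triple_point (r3 : {poly C}) :
  p.[0] = 0 -> q.[0] = 0 -> q^`().[0] = 0 ->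
  (forall v, r.[v] = v ^+ 3 * r3.[v]) -> False.
Proof.
move=> p0 q0 q1 er; have [xi [eta [ O1 O2 no]]] := Ak_transverse_arc M.
have eta0 := OpowW (leq0n 1) O2.
have [p1 ep] := horner_expand1 p; have [q2 [_ eq]] := horner_expand2 q.
apply: no; apply: Opow_opow.
have Oa := OpowZ a (OpowX 3 O1).
have Op := OpowM (OpowM O2 (OpowX 2 O1)) (Opow_horner p1 eta0).
have Oq := OpowM (OpowM (OpowX 2 O2) O1) (Opow_horner q2 eta0).
have Or := OpowM (OpowX 3 O2) (Opow_horner r3 eta0).
apply: eq_Opow (OpowD (OpowD (OpowD Oa Op) Oq) Or) => t.
by rewrite /cubic /= er ep p0 (eq (eta t)).1 q0 q1; ring.
Qed.

(** Here the cubic is [v^2 f]. Zeros on [v = 0] are all singular, and [f] vanishes at the others, so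
    [f] vanishes at the origin by continuity. *)
Lemma cubic_not_div_y2 (p2 q2 r2 : {poly C}) : a = 0 ->
  (forall v, p.[v] = v ^+ 2 * p2.[v]) -> (forall v, q.[v] = v ^+ 2 * q2.[v]) ->
  (forall v, r.[v] = v ^+ 2 * r2.[v]) -> p^`().[0] = 0 -> q^`().[0] = 0 ->
  r2.[0] = 0.
Proof.
move=> a0 ep eq er p1 q1; have [_ _ r1] := cubic_singular_origin.
pose f u v := p2.[v] * u ^+ 2 + q2.[v] * u + r2.[v].
have <- : f 0 0 = r2.[0] by rewrite /f expr0n !mulr0 !add0r.
apply: vanishing_on_smooth_points => [xi eta c1 c2|u v].
  by rewrite /f; converges_tac.
rewrite /cubic /cubic_dx /cubic_dy ep eq er a0 /= => G0 nsm.
have [v0|v0] := eqVneq v 0.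
  by case: nsm; rewrite v0 p1 q1 r1; split; ring.
have : v ^+ 2 * f u v = 0 by rewrite -G0 /f; ring.
by move/eqP; rewrite mulf_eq0 expf_eq0 (negPf v0) => /eqP.
Qed.

(** If [p(0) = 0], orders along the square arc successively force [q'(0) = 0], [r2(0) <> 0], [a = 0]
    and [p'(0) = 0]; the cubic is then divisible by [v^2]. *)
Lemma cubic_fiber_not_triple : (2 < k)%N -> (3 < k)%N || (p^`().[0] == 0) ->
  p.[0] != 0.
Proof.
move=> k2 kp; apply/eqP => p0; have [q0 r0 r1] := cubic_singular_origin.
have [xi [eta [ O1 O2 no [ Oc Ox Oy]]]] := cubic_square_arc k0 M.
have eta0 : Opow 0 eta by apply: OpowW O2.
have [p2 [_ ep]] := horner_expand2 p; have [q2 [_ eq]] := horner_expand2 q.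
have [r2 [_ er]] := horner_expand2 r; have [r3 er2] := horner_expand1 r2.
have Ox4 : Opow 4 (fun t => cubic_dx a p q (xi t) (eta t)) by apply: OpowW Ox.
have Oy4 : Opow 4 (fun t => cubic_dy p q r (xi t) (eta t)) by apply: OpowW Oy.
have H0 (P : {poly C}) : Opow 0 (fun t => P.[eta t]) by apply: Opow_horner.
have Op2 : Opow 0 (fun t => 2%:R * p2.[eta t] + eta t * p2^`().[eta t]).
  by apply: OpowD; [apply: OpowZ|apply: (OpowM eta0)].
have Oq2 : Opow 0 (fun t => 2%:R * q2.[eta t] + eta t * q2^`().[eta t]).
  by apply: OpowD; [apply: OpowZ|apply: (OpowM eta0)].
have Or2 : Opow 0 (fun t => 2%:R * r3.[eta t] + r2^`().[eta t]).
  by apply: OpowD; [apply: OpowZ|].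
have Op1 : Opow 0 (fun t => p^`().[0] + eta t * p2.[eta t]).
  by apply: OpowD; [apply: Opow_cst|apply: (OpowM eta0)].
(* Otherwise the quadratic part [q'(0) u v + r2(0) v^2] is nondegenerate: [G_u] makes [eta] small,
   and then [G_v] makes [xi] small. *)
have q1 : q^`().[0] = 0.
  apply/eqP/negPn/negP => q1; apply: no.
  have eta_small : opow 2 eta.
    apply: (opowZ_inv q1); apply: Opow_opow.
    have T1 : Opow 3 (fun t => 3%:R * a * xi t ^+ 2).
      by apply: OpowW (OpowZ _ (OpowX 2 O1)).
    have T2 : Opow 3 (fun t => 2%:R * (eta t * xi t *
        (p^`().[0] + eta t * p2.[eta t]))).
      by apply: OpowW (OpowZ _ (OpowM (OpowM O2 O1) Op1)).
    have T3 : Opow 3 (fun t => eta t ^+ 2 * q2.[eta t]).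
      by apply: OpowW (OpowM (OpowX 2 O2) (H0 q2)).
    have T0 := OpowW (ltnW (ltnSn 3)) Ox4.
    apply: eq_Opow (OpowB (OpowB (OpowB T0 T1) T2) T3) => t.
    by rewrite /cubic_dx (ep (eta t)).1 p0 (eq (eta t)).1 q0; ring.
  split => //; apply: (opowZ_inv q1).
  have T1 : Opow 3 (fun t => xi t ^+ 2 * p^`().[eta t]).
    by apply: OpowW (OpowM (OpowX 2 O1) (H0 _)).
  have T2 : Opow 3 (fun t => eta t * xi t *
      (2%:R * q2.[eta t] + eta t * q2^`().[eta t])).
    by apply: OpowW (OpowM (OpowM O2 O1) Oq2).
  have T3 : Opow 3 (fun t => eta t ^+ 2 *
      (2%:R * r3.[eta t] + r2^`().[eta t])).
    by apply: OpowW (OpowM (OpowX 2 O2) Or2).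
  have T0 := OpowW (ltnW (ltnSn 3)) Oy4.
  have o1 := Opow_opow (OpowB (OpowB (OpowB T0 T1) T2) T3).
  apply: eq_opow (opowD o1 (opowN (opowZ (2%:R * r2.[0]) eta_small))) => t.
  by rewrite /cubic_dy (eq (eta t)).2 (er (eta t)).2 r1 (er2 (eta t)); ring.
have r20 : r2.[0] != 0.
  apply/eqP => r20; apply: (@cubic_no_triple_point r3) => // v.
  by rewrite (er v).1 r0 r1 (er2 v) r20; ring.
have r20' : 2%:R * r2.[0] != 0 by rewrite mulf_neq0 ?pnatr_eq0.
(* [G_v] equals [2 r2(0) eta] up to [O(t^4)]. *)
have O4 : Opow 4 eta.
  have T1 : Opow 4 (fun t => xi t ^+ 2 * p^`().[eta t]).
    by apply: OpowM (OpowX 2 O1) (H0 _).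
  have T2 : Opow 4 (fun t => eta t * xi t *
      (2%:R * q2.[eta t] + eta t * q2^`().[eta t])).
    by apply: OpowM (OpowM O2 O1) Oq2.
  have T3 : Opow 4 (fun t => eta t ^+ 2 *
      (2%:R * r3.[eta t] + r2^`().[eta t])).
    by apply: OpowM (OpowX 2 O2) Or2.
  have T4 := OpowZ (2%:R * r2.[0])^-1 (OpowB (OpowB (OpowB Oy4 T1) T2) T3).
  apply: eq_Opow T4 => t; rewrite /cubic_dy (eq (eta t)).2 (er (eta t)).2 r1 q1.
  rewrite (er2 (eta t)).
  by rewrite -[RHS](mulKf r20'); congr (_ * _); ring.
have eta_small : opow 2 eta by apply: Opow_opow; apply: OpowW O4.
(* All terms of the cubic other than [a xi^3] are now [O(t^7)], which would give [xi = o(t^2)]. *)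
have a0 : a = 0.
  apply/eqP/negPn/negP => a0; apply: no; split => //.
  apply: (@opow_expr_inv _ 2 3) => //; apply: (opowZ_inv a0); apply: Opow_opow.
  have T1 := OpowM (OpowM O4 (OpowX 2 O1)) Op1.
  have T2 := OpowM (OpowM (OpowX 2 O4) O1) (H0 q2).
  have T3 := OpowM (OpowX 2 O4) (H0 r2).
  have T0 : Opow 7 (fun t => cubic a p q r (xi t, eta t)).
    by apply: OpowW Oc; lia.
  have {T1} T1 := OpowW (isT : 7 <= 4 + 2 * 2 + 0)%N T1.
  have {T2} T2 := OpowW (isT : 7 <= 4 * 2 + 2 + 0)%N T2.
  have {T3} T3 := OpowW (isT : 7 <= 4 * 2 + 0)%N T3.
  apply: eq_Opow (OpowB (OpowB (OpowB T0 T1) T2) T3) => t.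
  by rewrite /cubic /= (ep (eta t)).1 p0 (eq (eta t)).1 q0 q1 (er (eta t)).1 r0 r1; ring.
(* For [k >= 4], modulo higher order [G_v] is [p'(0) xi^2 + 2 r2(0) eta] and the cubic is
   [eta (p'(0) xi^2 + r2(0) eta)]; the combination [G_v^2 - 4 r2(0) G] leaves
   [p'(0)^2 xi^4 = O(t^9)]. *)
have p1 : p^`().[0] = 0.
  case/orP: kp => [k3|/eqP //]; apply/eqP/negPn/negP => p1; apply: no.
  split => //; have p12 : p^`().[0] ^+ 2 != 0 by rewrite expf_neq0.
  apply: (@opow_expr_inv _ 2 4) => //; apply: (opowZ_inv p12); apply: Opow_opow.
  have T0 : Opow 5 (fun t => cubic_dy p q r (xi t) (eta t)) by apply: OpowW Oy.
  have T1 : Opow 5 (fun t => eta t * xi t ^+ 2 *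
      (2%:R * p2.[eta t] + eta t * p2^`().[eta t])).
    by apply: OpowW (OpowM (OpowM O4 (OpowX 2 O1)) Op2).
  have T2 : Opow 5 (fun t => eta t * xi t *
      (2%:R * q2.[eta t] + eta t * q2^`().[eta t])).
    by apply: OpowW (OpowM (OpowM O4 O1) Oq2).
  have T3 : Opow 5 (fun t => eta t ^+ 2 *
      (2%:R * r3.[eta t] + r2^`().[eta t])).
    by apply: OpowW (OpowM (OpowX 2 O4) Or2).
  have S1 := OpowX 2 (OpowB (OpowB (OpowB T0 T1) T2) T3).
  have U0 : Opow 10 (fun t => cubic a p q r (xi t, eta t)).
    by apply: OpowW Oc; lia.
  have U1 : Opow 10 (fun t => eta t ^+ 2 * xi t ^+ 2 * p2.[eta t]).
    by apply: OpowW (OpowM (OpowM (OpowX 2 O4) (OpowX 2 O1)) (H0 _)).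
  have U2 : Opow 10 (fun t => eta t ^+ 2 * xi t * q2.[eta t]).
    by apply: OpowM (OpowM (OpowX 2 O4) O1) (H0 _).
  have U3 : Opow 10 (fun t => eta t ^+ 3 * r3.[eta t]).
    by apply: OpowW (OpowM (OpowX 3 O4) (H0 _)).
  have S2 := OpowZ (4%:R * r2.[0]) (OpowB (OpowB (OpowB U0 U1) U2) U3).
  apply: eq_Opow (OpowW (isT : 9 <= 10)%N (OpowB S1 S2)) => t.
  rewrite /cubic /cubic_dy /= (ep (eta t)).1 (ep (eta t)).2 p0.
  rewrite (eq (eta t)).1 (eq (eta t)).2 q0 q1.
  by rewrite (er (eta t)).1 (er (eta t)).2 r0 r1 (er2 (eta t)) a0; ring.
move/eqP: r20; apply; apply: (@cubic_not_div_y2 p2 q2 r2) => // v.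
- by rewrite (ep v).1 p0 p1; ring.
- by rewrite (eq v).1 q0 q1; ring.
- by rewrite (er v).1 r0 r1; ring.
Qed.

End CubicBound.

(** * Curves of bidegree (3, b) *)

Section Bound.
Variable R : realType.
Local Notation C := (Cplx R).

Lemma size_le1_horner0 (K : fieldType) (P : {poly K}) :
  (size P <= 1)%N -> P = (P.[0])%:P.
Proof. by move=> sP; rewrite horner_coef0; apply: size1_polyC. Qed.

Lemma cubic_Ak_bound (a : C) (p q r : {poly C}) (k b : nat)
    (Phi Psi : C * C -> C * C) (E : C * C -> C) (K d d' : R) :
  (0 < k)%N -> (0 < b)%N -> (size p <= (b %/ 3).+1)%N ->
  (size q <= (2 * b %/ 3).+1)%N -> (size r <= b.+1)%N ->
  Ak_model (cubic a p q r) k Phi Psi E K d d' -> (4 * k.+1 < 7 * b)%N.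
Proof.
move=> k0 b0 sp sq sr M; have [q0 r0 r1] := cubic_singular_origin k0 M.
(* For [b = 1] the degree bounds leave only [a u^3 + p(0) u^2], which has no [A_k] point at the
   origin: it has a triple point or a zero discriminant. *)
have [b1|b_neq1] := eqVneq b 1%N.
  rewrite b1 in sp sq sr; exfalso.
  have qE : q = 0 by rewrite (size_le1_horner0 sq) q0.
  have rE : r = 0.
    apply/polyP => -[|[|i]]; rewrite coef0.
    - by rewrite -horner_coef0.
    - by move: r1; rewrite horner_coef0 coef_deriv mulr1n.
    - by rewrite nth_default // (leq_trans sr).
  have [p0|p0] := eqVneq p.[0] 0.
    apply: (@cubic_no_triple_point _ _ _ _ _ _ _ _ _ _ _ _ M 0) => //.
      by rewrite qE deriv0 horner0.
    by move=> v; rewrite rE !horner0 mulr0.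
  have /eqP := cubic_disc_neq0 k0 M p0; apply.
  by rewrite /cubic_disc qE rE; ring.
have [p0|p0] := eqVneq p.[0] 0.
  rewrite ltnNge; apply/negP => kb.
  have k2 : (2 < k)%N by lia.
  suff kp : (3 < k)%N || (p^`().[0] == 0).
    by have := cubic_fiber_not_triple k0 M k2 kp; rewrite p0 eqxx.
  (* The negated bound gives [k >= 5] as soon as [b >= 3], but only [k >= 3] for [b = 2], where [p]
     is constant. *)
  have [b2|b_neq2] := eqVneq b 2%N; last by apply/orP; left; lia.
  rewrite b2 in sp; apply/orP; right.
  by rewrite (size_le1_horner0 sp) derivC horner0.
have [k1|k1] := leqP k 1; first by lia.
have [m [H [km H0 eD]]] := cubic_disc_order k0 M k1 p0.
(* From [k < m] and [3 m <= 5 b] one gets [12 (k + 1) <= 20 b < 21 b]. *)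
have := order_cubic_disc_le sp sq sr _ _ _ p0 q0 H0 (leq_trans k0 (ltnW km)) eD.
by lia.
Qed.

Lemma bidegree3_coef (b : nat) (F : {poly {poly C}}) (i j : nat) :
  has_bidegree 3 b F -> F`_i`_j != 0 -> (b * i + 3 * j <= 3 * b)%N.
Proof.
move=> [_ h] /h[u [v [u0 v0 uv iu jv]]].
rewrite -(ler_nat rat) natrD !natrM iu jv; have b0 := ler0n rat b.
have : (3%:R * b%:R) * (u + v) <= (3%:R * b%:R) * 1 :> rat.
  by rewrite ler_wpM2l // mulr_ge0.
by rewrite mulr1; apply: le_trans; rewrite le_eqVlt; apply/orP; left; apply/eqP; ring.
Qed.

(** Each unit of degree lost in [x] allows [b / 3] more degrees in [y]. Translation preserves these
    bounds, because a coefficient only receives contributions from higher powers of [x], whose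
    degrees in [y] are smaller. *)
Lemma bidegree3_cubic (b : nat) (F : {poly {poly C}}) (s : C * C) :
  (0 < b)%N -> has_bidegree 3 b F -> exists (a : C) (p q r : {poly C}),
    [/\ (size p <= (b %/ 3).+1)%N, (size q <= (2 * b %/ 3).+1)%N,
        (size r <= b.+1)%N
      & (fun h => eval2 F (s + h)) = cubic a p q r].
Proof.
move=> b0 hF; have Fz i j : (3 * b < b * i + 3 * j)%N -> F`_i`_j = 0.
  move=> hij; apply/eqP/negPn/negP => /(bidegree3_coef hF).
  by rewrite leqNgt hij.
have sF : (size F <= 4)%N.
  apply/leq_sizeP => i i4; apply/polyP => j; rewrite coef0; apply: Fz.
  have : (b * 4 <= b * i)%N by rewrite leq_mul.
  by lia.
have sFi i n : (3 * b < b * i + 3 * n.+1)%N -> (size (F`_i)%R <= n.+1)%N.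
  by move=> hn; apply/leq_sizeP => j nj; apply: Fz; lia.
have [a ea] : exists a, F`_3 = a%:P.
  by exists (F`_3)`_0; apply: size1_polyC; apply: sFi; lia.
pose x := s.1; pose f i := F`_i \Po ('X + s.2%:P).
have sf i n : (3 * b < b * i + 3 * n.+1)%N -> (size (f i) <= n.+1)%N.
  by move=> hn; rewrite size_comp_poly2 ?size_XaddC ?sFi.
pose p := f 2%N + (3%:R * a * x)%:P.
pose q := f 1%N + (2%:R * x) *: f 2%N + (3%:R * a * x ^+ 2)%:P.
pose r := f 0%N + x *: f 1%N + x ^+ 2 *: f 2%N + (a * x ^+ 3)%:P.
have sZ (c : C) (P : {poly C}) n : (size P <= n)%N -> (size (c *: P)%R <= n)%N.
  by apply: leq_trans; apply: size_scale_leq.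
exists a, p, q, r; split.
- by apply: size_add_le; [apply: sf; lia | apply: size_const_le].
- apply: size_add_le; last exact: size_const_le.
  by apply: size_add_le; [|apply: sZ]; apply: sf; lia.
- apply: size_add_le; last exact: size_const_le.
  apply: size_add_le; [apply: size_add_le|]; try apply: sZ; apply: sf; lia.
apply/funext => -[u v]; rewrite /eval2 /cubic /=.
rewrite (horner_coef_wide _ sF) horner_sum.
under eq_bigr => i _ do rewrite -polyC_exp hornerM hornerC.
rewrite !big_ord_recr big_ord0 /= ea.
rewrite /r /q /p !(hornerD, hornerZ, hornerC).
by rewrite !horner_comp !hornerD hornerX hornerC [v + _]addrC /x; ring.
Qed.

End Bound.

(** The bound [7 / 6] with denominators cleared. *)
Lemma bidegree3_Ak_bound (R : realType) (b k : nat) : (0 < b)%N ->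
  bidegree_curve_with_A R 3 b k -> (4 * k.+1 < 7 * b)%N.
Proof.
move=> b0 [F [s [hF]]]; case: k => [|k] /= hA; first by lia.
have [a [p [q [r [sp sq sr eF]]]]] := bidegree3_cubic s b0 hF.
have [Phi [Psi [E [K [d [d' M]]]]]] := given_by_Ak_model hA.
by rewrite eF in M; apply: (cubic_Ak_bound _ b0 sp sq sr M).
Qed.

(** The line [x = 0] shows that some [k] is attained, so that a maximum can be taken. *)
Lemma line_bidegree3 (R : realType) (b : nat) : bidegree_curve_with_A R 3 b 0.
Proof.
exists 'X, (0, 0); split; last first.
  split; first by rewrite /eval2 hornerX hornerC.
  by left; rewrite /eval2 /dx derivX hornerC hornerC oner_neq0.
split; first by rewrite polyX_eq0.
move=> i j; rewrite coefX; case: (eqVneq i 1%N) => [->|_]; last by rewrite coef0 eqxx.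
rewrite coefC; case: (eqVneq j 0%N) => [->|_]; last by rewrite eqxx.
by move=> _; exists (3%:R)^-1, 0; split; rewrite ?mul0r ?addr0 ?mulVf.
Qed.

Theorem lemma6p6 (R : realType) (b : nat) (hb : (1 <= b)%N) :
  exists N3b : nat,
    is_N R 3 b N3b /\
    (2%:R * (N3b%:R + 1) / (3%:R * b%:R) < 7%:R / 6%:R :> rat).
Proof.
pose P (k : nat) := `[< bidegree_curve_with_A R 3 b k >].
have exP : exists k, P k by exists 0%N; apply/asboolP/line_bidegree3.
(* Any upper bound suffices for the maximum to exist; the sharper one is applied afterwards to the
   maximum itself. *)
have ubP k : P k -> (k <= 7 * b)%N.
  by move=> /asboolP /(bidegree3_Ak_bound hb); lia.
case: (ex_maxnP exP ubP) => n /asboolP Pn max_n; exists n; split.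
  by split => // k hk; apply: max_n; apply/asboolP.
have := bidegree3_Ak_bound hb Pn; rewrite -(ltr_nat rat) !natrM -natr1 => bound.
have b0 : 0 < b%:R :> rat by rewrite ltr0n.
rewrite ltr_pdivrMr ?mulr_gt0 //.
by lra.
Qed.
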